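(* Let $K$ be an infinite field, $R = K[x_1,\ldots,x_n]$, and let $I \neq 0$ be a proper homogeneous ideal in $R$. Let $\mathrm{in}(I)$ be the initial ideal of $I$ with respect to the reverse lexicographic order with $x_1 > x_2 > \cdots > x_n$, and let $d = \dim(R/I)$. Let $J = (I,x_{n-d+1},\ldots,x_n)/I$ and $L = (\mathrm{in}(I),x_{n-d+1},\ldots,x_n)/\mathrm{in}(I)$. If the modules $a_{\mathbf{x}}^i(I)$ have finite length for all $i \in \{1,\ldots,d\}$, then $r_J(R/I) = r_L(R/\mathrm{in}(I))$.
   Context: $R$ carries the standard grading. For a homogeneous ideal $I \subseteq R$ put $I_0 = I$ and $I_i = I_{i-1} + (x_{n-i+1})$ for $i \in \{1,\ldots,n\}$, and define, with respect to the sequence $\mathbf{x} = x_n, x_{n-1}, \ldots, x_1$, $$a_{\mathbf{x}}^i(I) = \frac{I_{i-1} : (x_{n-i+1})}{I_{i-1}}, \qquad i = 1,\ldots,n.$$ For a homogeneous ideal $I$ let $\mathbf{m} = (x_1,\ldots,x_n)R/I$. A homogeneous ideal $J \subset \mathbf{m}$ of $R/I$ is called a reduction of $\mathbf{m}$ if $\mathbf{m}^{r+1} = J\mathbf{m}^r$ for some integer $r \geqslant 0$; it is a minimal reduction if it is minimal with respect to inclusion among reductions. The reduction number $r_J(R/I)$ of $\mathbf{m}$ with respect to a minimal reduction $J$ is the smallest $r \geqslant 0$ such that $\mathbf{m}^{r+1} = J\mathbf{m}^r$. Part of the assertion is that $J$ and $L$ are minimal reductions of the homogeneous maximal ideals of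 $R/I$ and $R/\mathrm{in}(I)$ respectively, so that both numbers are defined. *)

(* Defs.v *)
From HB Require Import structures.
From mathcomp Require Import all_boot all_order all_algebra.
From mathcomp Require Import mpoly.
From mathcomp Require Import boolp classical_sets cardinality.

Set Implicit Arguments.
Unset Strict Implicit.
Unset Printing Implicit Defensive.

Import GRing.Theory.
Local Open Scope ring_scope.
Local Open Scope quotient_scope.
Local Open Scope classical_set_scope.

(* The ideals of ring_quotient.v are boolean and proper by definition; here an
   ideal is an arbitrary set, and the unit ideal is allowed, so that sums,
   colons and quotients by them need no side condition. *)
Definition is_ideal (R : comPzRingType) (S : set R) : Prop :=
  S 0 /\ (forall a x y, S x -> S y -> S (a * x + y)).

Record ideal (R : comPzRingType) := Ideal {
  ideal_set :> set R;
  ideal_setP : is_ideal ideal_set }.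

Definition ideal_mem (R : comPzRingType) (N : ideal R) (x : R) : Prop :=
  ideal_set N x.
Coercion ideal_mem : ideal >-> Funclass.

Section IdealOps.
Variable R : comPzRingType.
Implicit Types (I J N : ideal R) (S : set R).

Lemma ideal_gen_subproof S :
  is_ideal [set a | forall N, S `<=` N -> N a].
Proof.
split=> [N _|a x y Sx Sy N SN]; first exact: (ideal_setP N).1.
by apply: (ideal_setP N).2; [exact: Sx | exact: Sy].
Qed.
Definition ideal_gen S : ideal R := Ideal (ideal_gen_subproof S).

Definition ideal_add I J : ideal R :=
  ideal_gen (I `|` J).

Definition ideal_mul I J : ideal R :=
  ideal_gen [set c | exists a b, [/\ I a, J b & c = a * b]].

Fixpoint ideal_exp I (k : nat) : ideal R :=
  if k is k'.+1 then ideal_mul I (ideal_exp I k') else ideal_gen [set 1].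

Lemma ideal_colon_subproof I (x : R) : is_ideal [set a | I (a * x)].
Proof.
split=> [|a y z /= Iy Iz]; first by rewrite /= mul0r; exact: (ideal_setP I).1.
by rewrite mulrDl -mulrA; exact: (ideal_setP I).2.
Qed.
(* I : (x) *)
Definition ideal_colon I (x : R) : ideal R := Ideal (ideal_colon_subproof I x).

Definition prime_ideal I : Prop :=
  ~ I 1 /\ forall a b, I (a * b) -> I a \/ I b.

End IdealOps.

Section QuotientRing.
Variable R : comPzRingType.
Variable I : ideal R.

Definition ideal_pred : {pred R} := fun x => `[< I x >].

Lemma ideal_pred_zmod_closed : zmod_closed ideal_pred.
Proof.
split=> [|x y /asboolP Ix /asboolP Iy]; apply/asboolP.
  exact: (ideal_setP I).1.
by rewrite addrC -mulN1r; exact: (ideal_setP I).2.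
Qed.
HB.instance Definition _ :=
  GRing.isZmodClosed.Build R ideal_pred ideal_pred_zmod_closed.

Definition quotient_ring := Quotient.quot ideal_pred.
HB.instance Definition _ := GRing.Zmodule.on quotient_ring.

Definition quotient_map (x : R) : quotient_ring :=
  \pi_(Quotient.quot ideal_pred) x.

Lemma quotient_mapE x y : (quotient_map x = quotient_map y) <-> I (x - y).
Proof.
split=> [/eqP|H].
  by rewrite /quotient_map -Quotient.idealrBE => /asboolP.
by apply/eqP; rewrite /quotient_map -Quotient.idealrBE; apply/asboolP.
Qed.

Lemma quotient_map_surj (a : quotient_ring) : exists x, quotient_map x = a.
Proof. by exists (repr a); exact: reprK. Qed.

Definition quotient_one : quotient_ring := quotient_map 1.
Definition quotient_mul (a b : quotient_ring) : quotient_ring :=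
  quotient_map (repr a * repr b).

Lemma quotient_mulE x y :
  quotient_mul (quotient_map x) (quotient_map y) = quotient_map (x * y).
Proof.
have IB z : I (repr (quotient_map z) - z).
  by apply/quotient_mapE; exact: reprK.
apply/quotient_mapE; set x' := repr _; set y' := repr _.
have -> : x' * y' - x * y = y' * (x' - x) + (x * (y' - y) + 0).
  rewrite addr0 !mulrBr [y' * x']mulrC [y' * x]mulrC.
  by rewrite addrA subrK.
apply: (ideal_setP I).2; first exact: IB.
by apply: (ideal_setP I).2; [exact: IB | exact: (ideal_setP I).1].
Qed.

Lemma quotient_mapD x y :
  quotient_map (x + y) = quotient_map x + quotient_map y.
Proof. exact: raddfD. Qed.

Lemma quotient_mulA : associative quotient_mul.
Proof.
move=> a b c; have [x <-] := quotient_map_surj a.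
have [y <-] := quotient_map_surj b; have [z <-] := quotient_map_surj c.
by rewrite !quotient_mulE mulrA.
Qed.
Lemma quotient_mulC : commutative quotient_mul.
Proof.
move=> a b; have [x <-] := quotient_map_surj a.
by have [y <-] := quotient_map_surj b; rewrite !quotient_mulE mulrC.
Qed.
Lemma quotient_mul1 : left_id quotient_one quotient_mul.
Proof.
by move=> a; have [x <-] := quotient_map_surj a; rewrite quotient_mulE mul1r.
Qed.
Lemma quotient_mulDl : left_distributive quotient_mul +%R.
Proof.
move=> a b c; have [x <-] := quotient_map_surj a.
have [y <-] := quotient_map_surj b; have [z <-] := quotient_map_surj c.
by rewrite -quotient_mapD !quotient_mulE mulrDl quotient_mapD.
Qed.

HB.instance Definition _ :=
  GRing.Zmodule_isComPzRing.Build quotient_ring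
    quotient_mulA quotient_mulC quotient_mul1 quotient_mulDl.

Lemma quotient_map_zmod : zmod_morphism quotient_map.
Proof. exact: raddfB. Qed.
HB.instance Definition _ :=
  GRing.isZmodMorphism.Build R quotient_ring quotient_map quotient_map_zmod.
Lemma quotient_map_monoid : monoid_morphism quotient_map.
Proof. by split=> // x y; rewrite -quotient_mulE. Qed.
HB.instance Definition _ :=
  GRing.isMonoidMorphism.Build R quotient_ring quotient_map quotient_map_monoid.

Lemma quotient_ideal_subproof (N : ideal R) : is_ideal (quotient_map @` N).
Proof.
split=> [|a _ _ [x Nx <-] [y Ny <-]].
  by exists 0; [exact: (ideal_setP N).1 | rewrite rmorph0].
have [z <-] := quotient_map_surj a; exists (z * x + y).
  exact: (ideal_setP N).2.
by rewrite rmorphD rmorphM.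
Qed.
(* (N + I) / I, that is N / I when I is contained in N *)
Definition quotient_ideal (N : ideal R) : ideal quotient_ring :=
  Ideal (quotient_ideal_subproof N).

End QuotientRing.

Section Dimension.
Variable A : comPzRingType.

Definition prime_chain (e : nat) : Prop :=
  exists P : nat -> ideal A,
    (forall i, (i <= e)%N -> prime_ideal (P i)) /\
    (forall i, (i < e)%N -> P i `<` P i.+1).

Definition has_krull_dim (d : nat) : Prop :=
  prime_chain d /\ forall e, prime_chain e -> (e <= d)%N.

(* N has a composition series as a module; its submodules are the ideals
   contained in N.  When A is a quotient ring R / P the R-submodules are the same
   sets, so this is also the length of N over R. *)
Definition finite_length (N : ideal A) : Prop :=
  exists (k : nat) (C : nat -> ideal A),
    [/\ C 0%N = [set 0] :> set A,
        C k = N :> set A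
      & forall i, (i < k)%N ->
          C i `<` C i.+1 /\
          (forall M : ideal A, C i `<=` M -> M `<=` C i.+1 ->
             M = C i :> set A \/ M = C i.+1 :> set A)].

End Dimension.

Section Reductions.
Variables (A : comPzRingType) (hom : set A).
(* hom is the set of homogeneous elements for the grading of A *)

Definition homogeneous_ideal (N : ideal A) : Prop :=
  N = ideal_gen (N `&` hom) :> set A.

Definition reduction_at (m J : ideal A) (r : nat) : Prop :=
  ideal_exp m r.+1 = ideal_mul J (ideal_exp m r) :> set A.

Definition is_reduction (m J : ideal A) : Prop :=
  [/\ homogeneous_ideal J, J `<=` m & exists r, reduction_at m J r].

Definition is_minimal_reduction (m J : ideal A) : Prop :=
  is_reduction m J /\
  forall J' : ideal A, is_reduction m J' -> J' `<=` J -> J' = J :> set A.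

(* 0 by convention if J is not a reduction *)
Definition reduction_number (m J : ideal A) : nat :=
  xget 0%N [set r | reduction_at m J r /\
                    forall s, reduction_at m J s -> (r <= s)%N].

End Reductions.

Section SequenceQuotients.
Variable R : comPzRingType.

Fixpoint ideal_add_seq (xs : seq R) (I : ideal R) (i : nat) : ideal R :=
  if i is j.+1
  then ideal_add (ideal_add_seq xs I j) (ideal_gen [set xs`_j])
  else I.

(* a_xs^i(I), for 1 <= i <= size xs; the i-th term of the sequence is
   xs`_i.-1 *)
Definition seq_colon_quotient (xs : seq R) (I : ideal R) (i : nat) :
    ideal (quotient_ring (ideal_add_seq xs I i.-1)) :=
  quotient_ideal (ideal_add_seq xs I i.-1)
    (ideal_colon (ideal_add_seq xs I i.-1) xs`_i.-1).

End SequenceQuotients.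

Section Polynomials.
Variables (K : fieldType) (n : nat).
Local Notation R := {mpoly K[n]}.
Implicit Types (I : ideal R) (f : R) (m : 'X_{1..n}).

(* The variable x_i is 'X_(i-1). *)

Definition homogeneous_poly : set R :=
  [set f | exists k : nat, f \is k.-homog].

Definition homogeneous_quotient I : set (quotient_ring I) :=
  quotient_map I @` homogeneous_poly.

(* Graded reverse lexicographic order with x_1 > ... > x_n.  The order
   provided by mpoly.v on 'X_{1..n}, despite its name there, is the graded
   lexicographic one. *)
Definition revlex_lt m1 m2 : Prop :=
  (mdeg m1 < mdeg m2)%N \/
  mdeg m1 = mdeg m2 /\
  exists i : 'I_n, (m2 i < m1 i)%N /\ forall j : 'I_n, (i < j)%N -> m1 j = m2 j.

Definition is_initial_monomial f m : Prop :=
  m \in msupp f /\ forall m', m' \in msupp f -> m' = m \/ revlex_lt m' m.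

Definition initial_ideal I : ideal R :=
  ideal_gen [set g | exists f m,
    [/\ I f, is_initial_monomial f m & g = 'X_[m]]].

(* x_n, x_(n-1), ..., x_1 *)
Definition rev_vars : seq R := rev [seq 'X_i | i : 'I_n].

Definition irrelevant_ideal I : ideal (quotient_ring I) :=
  ideal_gen [set quotient_map I 'X_i | i in [set: 'I_n]].

(* (I, x_(n-d+1), ..., x_n) / I *)
Definition last_vars_ideal I (d : nat) : ideal (quotient_ring I) :=
  quotient_ideal I
    (ideal_gen (I `|` [set 'X_i | i in [set i : 'I_n | (n - d <= i)%N]])).

End Polynomials.

Arguments homogeneous_poly K n : clear implicits.
Arguments homogeneous_quotient {K n} I _.

(* Main.v *)
(* Modulo J the ring R/I becomes R/(I + (last d variables)), so J is a reduction
   with m^(r+1) = J m^r exactly when all monomials of degree r+1 lie in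
   I + (x_(n-d+1), ..., x_n); the same holds for in(I).  In the reverse
   lexicographic order a monomial in which one of the last d variables occurs is
   smaller than any monomial of the same degree without them, so that the two
   conditions agree, and the reduction numbers with them.

   That some r works comes from finite length: if a prime P strictly below the
   irrelevant ideal contains I_i, some element outside P kills a^i(I), hence P
   strictly contains a prime over I_(i-1).  If a variable were not nilpotent modulo
   I + (last d variables), this would give a chain of primes of length d + 1 over I.

   For minimality, a reduction strictly inside J (or L) has fewer than d
   independent linear forms l_1, ..., l_k.  Then R/I in degree <= T is spanned by
   O(T^k) elements, whereas a chain of d + 1 primes yields d algebraically
   independent elements, that is, about T^d independent products. *)

Require Import Defs.
From mathcomp Require Import all_boot all_order all_algebra.
From mathcomp Require Import mpoly ring zify.
From mathcomp Require Import boolp classical_sets cardinality.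

Set Implicit Arguments.
Unset Strict Implicit.
Unset Printing Implicit Defensive.

Import GRing.Theory.
Local Open Scope ring_scope.
Local Open Scope classical_set_scope.

(** * Ideals, primes and filter-regular sequences *)

Section IdealTheory.
Variable R : comPzRingType.
Implicit Types (I J N P : ideal R) (S : set R).

Lemma ideal_memMD N a x y : N x -> N y -> ideal_set N (a * x + y).
Proof. exact: (ideal_setP N).2. Qed.

Lemma ideal_mem0 N : ideal_set N 0.
Proof. exact: (ideal_setP N).1. Qed.

Lemma ideal_memD N x y : N x -> N y -> ideal_set N (x + y).
Proof. by move=> Nx Ny; rewrite -[x]mul1r; exact: ideal_memMD. Qed.

Lemma ideal_memMl N a x : N x -> ideal_set N (a * x).
Proof.
by move=> Nx; rewrite -[_ * _]addr0; apply: ideal_memMD => //; exact: ideal_mem0.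
Qed.

Lemma ideal_memMr N a x : N x -> ideal_set N (x * a).
Proof. by rewrite mulrC; exact: ideal_memMl. Qed.

Lemma ideal_memN N x : N x -> ideal_set N (- x).
Proof. by rewrite -mulN1r; exact: ideal_memMl. Qed.

Lemma ideal_memB N x y : N x -> N y -> ideal_set N (x - y).
Proof. by move=> Nx Ny; apply: ideal_memD => //; exact: ideal_memN. Qed.

Lemma ideal_mem_sum N (T : Type) (r : seq T) (p : pred T) (F : T -> R) :
  (forall i, p i -> N (F i)) -> ideal_set N (\sum_(i <- r | p i) F i).
Proof.
move=> NF; elim/big_ind: _ => //; [exact: ideal_mem0 | exact: ideal_memD].
Qed.

Lemma ideal_mem_cong N x y : N (x - y) -> N y -> ideal_set N x.
Proof. by move=> Nxy Ny; rewrite -(subrK y x); exact: ideal_memD. Qed.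

Lemma sub_ideal_gen S : S `<=` ideal_gen S.
Proof. by move=> x Sx N; apply. Qed.

Lemma ideal_gen_sub S N : S `<=` N -> ideal_gen S `<=` N.
Proof. by move=> SN x; apply. Qed.

Lemma ideal_addl I J : I `<=` ideal_add I J.
Proof. by move=> x Ix; apply: sub_ideal_gen; left. Qed.

Lemma ideal_addr I J : J `<=` ideal_add I J.
Proof. by move=> x Jx; apply: sub_ideal_gen; right. Qed.

Lemma ideal_addP I J x :
  ideal_add I J x <-> exists y z, [/\ I y, J z & x = y + z].
Proof.
split=> [|[y [z [Iy Jz ->]]]]; last first.
  by apply: ideal_memD; [exact: ideal_addl | exact: ideal_addr].
suff idT : is_ideal [set x | exists y z, [/\ I y, J z & x = y + z]].
  apply: (@ideal_gen_sub _ (Ideal idT)) => y [Iy|Jy].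
    by exists y, 0; split; rewrite ?addr0 //; exact: ideal_mem0.
  by exists 0, y; split; rewrite ?add0r //; exact: ideal_mem0.
split; first by exists 0, 0; split; rewrite ?addr0 //; exact: ideal_mem0.
move=> a _ _ [y [z [Iy Jz ->]]] [y' [z' [Iy' Jz' ->]]].
exists (a * y + y'), (a * z + z'); split; try exact: ideal_memMD.
by rewrite mulrDr addrACA.
Qed.

Lemma ideal_mulS I J N :
  (forall a b, I a -> J b -> N (a * b)) -> ideal_mul I J `<=` N.
Proof. by move=> IJN; apply: ideal_gen_sub => _ [a [b [Ia Jb ->]]]; exact: IJN. Qed.

Lemma mem_ideal_mul I J a b : I a -> J b -> ideal_mul I J (a * b).
Proof. by move=> Ia Jb; apply: sub_ideal_gen; exists a, b. Qed.

(** An ideal maximal among those containing [N] and disjoint from the multiplicative set [S] is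
    prime, and Zorn's lemma provides one. *)
Lemma prime_avoiding N S :
    S 1 -> (forall a b, S a -> S b -> S (a * b)) -> (forall a, N a -> ~ S a) ->
  exists P, [/\ prime_ideal P, N `<=` P & forall a, P a -> ~ S a].
Proof.
move=> S1 SM NS.
(* The property is put on [N]|[A] rather than on [A], so that the empty chain, whose union is empty,
   still yields the ideal [N]. *)
have [|A [[idA AS] maxA]] := @Zorn_bigcup R
    [set A | is_ideal (N `|` A) /\ forall a, (N `|` A) a -> ~ S a].
  move=> F FP totF; split; last first.
    by move=> a [/NS //|[A FA Aa]]; apply: (FP A FA).2; right.
  split=> [|a x y]; first by left; exact: ideal_mem0.
  have NUl A z : F A -> (N `|` A) z -> (N `|` \bigcup_(X in F) X) z.
    by move=> FA [?|?]; [left | right; exists A].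
  case=> [Nx|[A FA Ax]] [Ny|[B FB By]].
  - by left; exact: ideal_memMD.
  - by apply: (NUl B) => //; apply: (FP B FB).1.2; [left | right].
  - by apply: (NUl A) => //; apply: (FP A FA).1.2; [right | left].
  - have [AB|BA] := totF _ _ FA FB.
      by apply: (NUl B) => //; apply: (FP B FB).1.2; right => //; exact: AB.
    by apply: (NUl A) => //; apply: (FP A FA).1.2; right => //; exact: BA.
pose P := Ideal idA; exists P; split=> //; last by move=> x ?; left.
split=> [P1|a b Pab]; first exact: (AS 1).
(* P is maximal among the ideals avoiding S *)
have meet c : ~ P c -> exists y r, P y /\ S (y + r * c).
  move=> nPc; apply: contrapT => nS.
  pose Q := ideal_add P (ideal_gen [set c]).
  have NQ : N `<=` Q by move=> x Nx; apply: ideal_addl; left.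
  have NQE : N `|` Q = Q by rewrite eqEsubset; split=> [x [/NQ|]|x ?] //; right.
  apply: (maxA Q).
    split=> [x Ax|QA]; first by apply: ideal_addl; right.
    by apply: nPc; right; apply: QA; apply: ideal_addr; exact: sub_ideal_gen.
  split; rewrite NQE; first exact: ideal_setP.
  move=> x /ideal_addP[y [z [Py cz ->]]] Sx; apply: nS.
  suff [r zE] : exists r, z = r * c by exists y, r; rewrite -zE.
  suff idc : is_ideal [set z | exists r, z = r * c].
    apply: (@ideal_gen_sub _ (Ideal idc)) cz => _ ->.
    by exists 1; rewrite mul1r.
  split; first by exists 0; rewrite mul0r.
  by move=> u _ _ [r ->] [s ->]; exists (u * r + s); ring.
apply: contrapT => /not_orP[/meet[y [r [Py Sy]]] /meet[z [s [Pz Sz]]]].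
apply: (AS _ _ (SM _ _ Sy Sz)).
have -> : (y + r * a) * (z + s * b) =
          (z + s * b) * y + ((r * a) * z + (r * s) * (a * b)) by ring.
apply: (@ideal_memMD P) => //; apply: (@ideal_memMD P) => //.
exact: (@ideal_memMl P).
Qed.

End IdealTheory.

(** * Annihilators of modules of finite length *)

Section FiniteLength.
Variable A : comPzRingType.

(* The simple module D / C is annihilated by x, or by some 1 - a * x since x
   acts on it bijectively. *)
Lemma simple_factor_killed (C D : ideal A) (S : set A) (x : A) :
    S x -> (forall a, S (1 - a * x)) -> C `<=` D ->
    (forall M : ideal A, C `<=` M -> M `<=` D ->
       M = C :> set A \/ M = D :> set A) ->
  exists t, S t /\ forall c, D c -> C (t * c).
Proof.
move=> Sx S1x CD simple.
have [kx|/existsNP[c /not_implyP[Dc nCxc]]] := pselect (forall c, D c -> C (x * c)).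
  by exists x.
(* This is [C + (x * c)], an ideal between [C] and [D] and different from [C]. Once it equals [D],
   the element [c] is congruent to some [a * x * c] modulo [C], so [1 - a * x] kills [D / C]. *)
have idM : is_ideal [set y | exists a, C (y - a * (x * c))].
  split; first by exists 0; rewrite mul0r subr0; exact: ideal_mem0.
  move=> a y z [b Cb] [e Ce]; exists (a * b + e).
  have -> : a * y + z - (a * b + e) * (x * c) =
            a * (y - b * (x * c)) + (z - e * (x * c)) by ring.
  exact: ideal_memMD.
have [||/= MC|/= MD] := simple (Ideal idM).
- by move=> y Cy; exists 0; rewrite mul0r subr0.
- move=> y [a Cy]; apply: ideal_mem_cong (CD _ Cy) _.
  by do 2 apply: ideal_memMl.
- case: nCxc; rewrite /ideal_mem -MC; exists 1.
  by rewrite mul1r subrr; exact: ideal_mem0.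
have [a Ca] : [set y | exists a, C (y - a * (x * c))] c by rewrite MD.
exists (1 - a * x); split=> // y.
rewrite {1}/ideal_mem -MD => -[b Cy].
have -> : (1 - a * x) * y = (1 - a * x) * (y - b * (x * c)) +
   (b * x) * (c - a * (x * c)) by ring.
by apply: ideal_memMD => //; exact: ideal_memMl.
Qed.

(** Each factor of a composition series is killed by an element of [S]; the product of these
    elements kills the whole module. *)
Lemma finite_length_killed (N : ideal A) (S : set A) (x : A) :
    S 1 -> (forall a b, S a -> S b -> S (a * b)) ->
    S x -> (forall a, S (1 - a * x)) -> finite_length N ->
  exists t, S t /\ forall c, N c -> t * c = 0.
Proof.
move=> S1 SM Sx S1x [k [C [C0 Ck Cs]]].
suff /(_ k (leqnn k))[t [St tC]] : forall i, (i <= k)%N ->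
    exists t, S t /\ forall c, C i c -> t * c = 0.
  by exists t; split=> // c Nc; apply: tC; rewrite /ideal_mem Ck.
elim=> [_|i IHi ik].
  by exists 1; split=> // c; rewrite /ideal_mem C0 => ->; rewrite mulr0.
have [t [St tC]] := IHi (ltnW ik).
have [[CC _] simple] := Cs i ik.
have [u [Su uC]] := simple_factor_killed Sx S1x CC simple.
by exists (t * u); split=> [|c /uC/tC]; [exact: SM | rewrite mulrA].
Qed.

End FiniteLength.

(** * Ideals and chains of primes in a quotient ring *)

Section QuotientIdeals.
Variables (R : comPzRingType) (I : ideal R).
Implicit Types (N P : ideal R) (Q : ideal (quotient_ring I)).

Lemma quotient_map_eq0 x : quotient_map I x = 0 <-> I x.
Proof. by rewrite -(rmorph0 (quotient_map I)) quotient_mapE subr0. Qed.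

Lemma quotient_idealP N x :
  quotient_ideal I N (quotient_map I x) <-> ideal_add I N x.
Proof.
rewrite ideal_addP; split=> [[y Ny /quotient_mapE Iyx]|[y [z [Iy Nz ->]]]].
  exists (x - y), y; split=> //; last by rewrite subrK.
  by rewrite -opprB; exact: ideal_memN.
exists z => //; apply/quotient_mapE; rewrite opprD addrCA subrr addr0.
exact: ideal_memN.
Qed.

Lemma quotient_idealE N x : I `<=` N ->
  quotient_ideal I N (quotient_map I x) <-> N x.
Proof.
move=> IN; rewrite quotient_idealP; split; last exact: ideal_addr.
by apply: ideal_gen_sub => y [/IN|].
Qed.

Lemma preim_ideal_subproof Q : is_ideal (quotient_map I @^-1` Q).
Proof.
split=> [|a x y]; rewrite /= ?rmorph0; first exact: ideal_mem0.
by rewrite rmorphD rmorphM; exact: ideal_memMD.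
Qed.
Definition preim_ideal Q : ideal R := Ideal (preim_ideal_subproof Q).

Lemma preim_idealE Q x : ideal_set (preim_ideal Q) x = Q (quotient_map I x).
Proof. by []. Qed.

Lemma preim_ideal_sub Q : I `<=` preim_ideal Q.
Proof.
by move=> x /quotient_map_eq0; rewrite /= /preimage /= => ->; exact: ideal_mem0.
Qed.

Lemma prime_preim_ideal Q : prime_ideal Q -> prime_ideal (preim_ideal Q).
Proof.
move=> [nQ1 Qprime]; split=> [|a b]; rewrite /ideal_mem /= /preimage /=.
  by rewrite rmorph1.
by rewrite rmorphM => /Qprime.
Qed.

Lemma prime_quotient_ideal P : I `<=` P -> prime_ideal P ->
  prime_ideal (quotient_ideal I P).
Proof.
move=> IP [nP1 Pprime]; split.
  by rewrite -(rmorph1 (quotient_map I)) quotient_idealE.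
move=> a b; have [x <-] := quotient_map_surj a; have [y <-] := quotient_map_surj b.
by rewrite -rmorphM !quotient_idealE //; exact: Pprime.
Qed.

Lemma quotient_prime_chain e (P : nat -> ideal R) :
    I `<=` P 0%N -> (forall i, (i <= e)%N -> prime_ideal (P i)) ->
    (forall i, (i < e)%N -> P i `<` P i.+1) ->
  prime_chain (quotient_ring I) e.
Proof.
move=> IP0 Pprime Plt.
have IP i : (i <= e)%N -> I `<=` P i.
  elim: i => // i IHi ie; apply: subset_trans (IHi (ltnW ie)) _.
  exact: (Plt i ie).1.
exists (fun i => quotient_ideal I (P i)); split=> [i ie|i ie].
  by apply: prime_quotient_ideal; [exact: IP | exact: Pprime].
split; first by move=> _ [x Px <-]; exists x => //; exact: (Plt i ie).1.
move=> PP; apply: (Plt i ie).2 => x Px; apply/(quotient_idealE x (IP i (ltnW ie))).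
by apply: PP; exists x.
Qed.

Lemma prime_chain_preim e : prime_chain (quotient_ring I) e ->
  exists P : nat -> ideal R,
    [/\ I `<=` P 0%N, forall i, (i <= e)%N -> prime_ideal (P i)
      & forall i, (i < e)%N -> P i `<` P i.+1].
Proof.
move=> [Q [Qprime Qlt]]; exists (fun i => preim_ideal (Q i)); split=> [|i ie|i ie].
- exact: preim_ideal_sub.
- by apply: prime_preim_ideal; exact: Qprime.
- have [QQ nQQ] := Qlt i ie; split; first by move=> x /QQ.
  move=> PP; apply: nQQ => a; have [x <-] := quotient_map_surj a; exact: PP.
Qed.

End QuotientIdeals.

(** * Descent of primes along a filter-regular sequence *)

Section FilterRegular.
Variable R : comPzRingType.

(** The element [y] witnesses that [P] is not maximal: it is neither zero nor invertible modulo [P].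
    Finite length then gives [t] outside [P] with [t (N : x)] inside [N], so [x] is a nonzerodivisor
    on [R / N] localized at [P], and some prime over [N] inside [P] misses [x]. *)
Lemma filter_regular_prime (N P : ideal R) (x y : R) :
    prime_ideal P -> N `<=` P -> P x ->
    ~ P y -> (forall a, ~ P (1 - a * y)) ->
    finite_length (quotient_ideal N (ideal_colon N x)) ->
  exists Q : ideal R, [/\ prime_ideal Q, N `<=` Q & Q `<` P].
Proof.
move=> [nP1 Pprime] NP Px nPy nP1y flen.
have nPM a b : ~ P a -> ~ P b -> ~ P (a * b) by move=> ? ? /Pprime[].
have [||||_ [[t nPt <-] tN]] := @finite_length_killed _ _
  (quotient_map N @` [set a | ~ P a]) (quotient_map N y) _ _ _ _ flen.
- by exists 1; rewrite ?rmorph1.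
- move=> _ _ [a Pa <-] [b Pb <-]; exists (a * b); last by rewrite rmorphM.
  exact: nPM.
- by exists y.
- move=> c; have [a <-] := quotient_map_surj c; exists (1 - a * y); first exact: nP1y.
  by rewrite rmorphB rmorph1 rmorphM.
pose S : set R := [set b | exists s k, ~ P s /\ b = s * x ^+ k].
have [|||Q [Qprime NQ QS]] := @prime_avoiding R N S.
- by exists 1, 0%N; rewrite expr0 mulr1.
- move=> _ _ [s [k [nPs ->]]] [u [l [nPu ->]]]; exists (s * u), (k + l)%N.
  by split; [exact: nPM | rewrite exprD; ring].
(* Powers of [x] are removed one at a time: if [s * x ^+ k.+1] is in [N], then [s * x ^+ k] is in
   [N : x], so [t * s * x ^+ k] is in [N]. At the end an element outside [P] would lie in [N]. *)
- move=> a Na [s [k [nPs aE]]]; move: Na; rewrite {}aE.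
  elim: k s nPs => [|k IHk] s nPs; first by rewrite expr0 mulr1 => /NP.
  rewrite exprSr mulrA => Nsx; apply: (IHk (t * s)); first exact: nPM.
  rewrite -mulrA; apply/quotient_map_eq0; rewrite rmorphM; apply: tN.
  by exists (s * x ^+ k).
exists Q; split=> //; split; last first.
  move=> PQ; apply: (QS x (PQ _ Px)); exists 1, 1%N.
  by rewrite expr1 mul1r.
move=> z Qz; apply: contrapT => nPz; apply: (QS z Qz); exists z, 0%N.
by rewrite expr0 mulr1.
Qed.

Lemma ideal_add_seqS xs (I : ideal R) i :
  ideal_add_seq xs I i `<=` ideal_add_seq xs I i.+1.
Proof. exact: ideal_addl. Qed.

(** One strictly smaller prime is found for each term of the sequence, going down from [P]. The two
    conditions on [y] pass to smaller primes, so the descent can be repeated. *)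
Lemma filter_regular_chain (xs : seq R) (I : ideal R) (y : R) i (P : ideal R) :
    (forall j, (1 <= j <= i)%N -> finite_length (seq_colon_quotient xs I j)) ->
    prime_ideal P -> ideal_add_seq xs I i `<=` P ->
    ~ P y -> (forall a, ~ P (1 - a * y)) ->
  exists C : nat -> ideal R,
    [/\ I `<=` C 0%N, C i = P, forall j, (j <= i)%N -> prime_ideal (C j)
      & forall j, (j < i)%N -> C j `<` C j.+1].
Proof.
elim: i P => [|i IHi] P flen Pprime IP nPy nP1y.
  by exists (fun=> P); split.
have [|||Q [Qprime NQ [QP nPQ]]] := @filter_regular_prime
    (ideal_add_seq xs I i) P xs`_i y Pprime _ _ nPy nP1y (flen i.+1 _).
- exact: subset_trans (@ideal_add_seqS _ _ _) IP.
- by apply: IP; apply: ideal_addr; exact: sub_ideal_gen.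
- by rewrite leqnn.
have [|||C [IC Ci Cprime Clt]] := IHi Q _ Qprime NQ.
- by move=> j /andP[j0 ji]; apply: flen; rewrite j0 ltnW.
- by move=> /QP.
- by move=> a /QP; exact: nP1y.
exists (fun j => if (j <= i)%N then C j else P); split=> //=.
- by rewrite ltnn.
- by move=> j; rewrite leq_eqVlt ltnS => /orP[/eqP->|ji]; rewrite ?ltnn // ji; exact: Cprime.
- move=> j; rewrite ltnS leq_eqVlt => /orP[/eqP->|ji].
    by rewrite eqxx ltnn Ci.
  by rewrite ji orbT; exact: Clt.
Qed.

End FilterRegular.

(** * Graded ideals *)

#[local] Arguments ideal_mem : simpl never.
#[local] Arguments ideal_set : simpl never.

Section GradedIdeals.
Variables (K : fieldType) (n : nat).
Local Notation R := {mpoly K[n]}.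
Local Notation hpart k := (@pihomog n K mdeg k).
Implicit Types (I N : ideal R) (S : set R) (f g h : R) (m : 'X_{1..n}).
Implicit Types (U : set 'X_{1..n}).

Lemma ideal_memZ N c f : N f -> ideal_set N (c *: f).
Proof. by rewrite -mul_mpolyC; exact: ideal_memMl. Qed.

Lemma mcoeff_hpart k f m : (hpart k f)@_m = if mdeg m == k then f@_m else 0.
Proof.
elim/mpolyind: f => [|c m' f _ _ IHf]; first by rewrite raddf0 mcoeff0 if_same.
rewrite linearP /= pihomogX mcoeffD IHf mcoeffZ mcoeffD mcoeffZ mcoeffX.
have [<-|ne] := eqVneq m' m.
  by case: ifP; rewrite ?mcoeffX ?eqxx ?mcoeff0 ?mulr0 ?add0r.
case: ifP; rewrite ?mcoeffX ?(negPf ne) ?mcoeff0 mulr0 !add0r //.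
Qed.

Lemma hpartXM k m f : hpart k ('X_[m] * f) =
  if (mdeg m <= k)%N then 'X_[m] * hpart (k - mdeg m) f else 0.
Proof.
elim/mpolyind: f => [|c m' f _ _ IHf]; first by rewrite mulr0 !raddf0 mulr0 if_same.
rewrite mulrDr raddfD /= IHf -scalerAr linearZ /= -mpolyXD pihomogX /= mdegD.
rewrite linearP /= pihomogX /=.
case: leqP => [mk|mk].
  rewrite mulrDr -scalerAr -(eqn_add2l (mdeg m) _ (k - mdeg m)) subnKC //.
  by case: ifP; rewrite ?mulr0 // mpolyXD.
by rewrite addr0 ifF ?scaler0 //; apply/eqP; lia.
Qed.

(** Homogeneity as closure under homogeneous components; [homogeneous_hclosed] derives it from
    generation by homogeneous elements. *)
Definition hclosed N := forall k f, N f -> N (hpart k f).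

Lemma hpart_sum f : f = \sum_(k < msize f) hpart k f.
Proof. exact: pihomog_partitionE. Qed.

(** The polynomials all of whose components lie in the ideal form an ideal themselves, because
    multiplication by a monomial only shifts degrees. *)
Lemma hclosed_gen S : (forall k s, S s -> ideal_gen S (hpart k s)) ->
  hclosed (ideal_gen S).
Proof.
move=> hS k f Sf.
suff idT : is_ideal [set f | forall k, ideal_gen S (hpart k f)].
  by apply: (@ideal_gen_sub _ S (Ideal idT)) Sf k => s Ss k; exact: hS.
split=> [j|a x y Sx Sy j]; rewrite ?raddf0 ?raddfD /=; first exact: ideal_mem0.
apply: ideal_memD => //; rewrite [a]mpolyE mulr_suml raddf_sum.
apply: ideal_mem_sum => m _; rewrite -scalerAl /= linearZ /= hpartXM.
apply: ideal_memZ; case: ifP => _; last exact: ideal_mem0.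
exact: ideal_memMl.
Qed.

Lemma homogeneous_hclosed I : homogeneous_ideal (homogeneous_poly K n) I -> hclosed I.
Proof.
move=> Ihom k f; rewrite /ideal_mem Ihom; apply: hclosed_gen => j s [Is [e se]].
have [<-|ne] := eqVneq e j.
  by rewrite pihomog_dE //; apply: sub_ideal_gen; split=> //; exists e.
by rewrite (pihomog_ne0 ne) //; exact: ideal_mem0.
Qed.

Lemma quotient_ideal_homogeneous I N : hclosed N ->
  homogeneous_ideal (homogeneous_quotient I) (quotient_ideal I N).
Proof.
move=> hN; rewrite /homogeneous_ideal eqEsubset; split; last first.
  by apply: ideal_gen_sub => x [].
move=> _ [f Nf <-]; rewrite [f]hpart_sum rmorph_sum.
apply: (@ideal_mem_sum (quotient_ring I) (ideal_gen _)) => k _.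
apply: sub_ideal_gen; split; exists (hpart k f) => //; first exact: hN.
by exists k; exact: pihomogP.
Qed.

Definition upset U := forall m m', U m -> U (m + m')%MM.

Lemma monomial_ideal_subproof U : upset U ->
  is_ideal [set f : R | forall m, m \in msupp f -> U m].
Proof.
move=> upU; split=> [m|a x y Ux Uy m]; first by rewrite msupp0.
move=> /msuppD_le; rewrite mem_cat => /orP[/msuppM_le|/Uy//].
by move=> /allpairsP[[m1 m2] /= [_ /Ux Um ->]]; rewrite addmC; exact: upU.
Qed.
(** A monomial ideal is encoded by an upward closed set of exponents, which makes membership a
    condition on the support. *)
Definition monomial_ideal U (upU : upset U) : ideal R :=
  Ideal (monomial_ideal_subproof upU).

Lemma monomial_idealX U (upU : upset U) m : monomial_ideal upU 'X_[m] <-> U m.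
Proof.
split=> [|Um m']; first by apply; rewrite msuppX mem_seq1.
by rewrite msuppX mem_seq1 => /eqP ->.
Qed.

Lemma monomial_ideal_sub U (upU : upset U) N :
  (forall m, U m -> N 'X_[m]) -> monomial_ideal upU `<=` N.
Proof.
move=> UN f Uf; rewrite [f]mpolyE big_seq_cond; apply: ideal_mem_sum => m.
by rewrite andbT => /Uf/UN; exact: ideal_memZ.
Qed.

Lemma msupp_hpart k f m : m \in msupp (hpart k f) = (mdeg m == k) && (m \in msupp f).
Proof. by rewrite !mcoeff_msupp mcoeff_hpart; case: ifP => //; rewrite eqxx. Qed.

Lemma hclosed_monomial_ideal U (upU : upset U) : hclosed (monomial_ideal upU).
Proof. by move=> k f Uf m; rewrite msupp_hpart => /andP[_ /Uf]. Qed.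

Lemma upset_mdeg r : upset [set m | (r <= mdeg m)%N].
Proof. by move=> m m' /= rm; rewrite mdegD; exact: leq_trans rm (leq_addr _ _). Qed.
(** This is the [r]-th power of the ideal generated by the variables. *)
Definition order_ideal r := monomial_ideal (upset_mdeg (r := r)).

Lemma hclosed_proper N : hclosed N -> ~ N 1 -> N `<=` order_ideal 1.
Proof.
move=> hN nN1 f Nf m mf /=; rewrite lt0n mdeg_eq0; apply/eqP => m0; subst m.
apply: nN1; have -> : 1 = (f@_0)^-1 *: hpart 0 f.
  apply/mpolyP => m; rewrite mcoeffZ mcoeff_hpart mcoeff1 mdeg_eq0.
  by case: eqP => [->|]; rewrite ?mulr0 // mulVf // -mcoeff_msupp.
by apply: ideal_memZ; exact: hN.
Qed.

Variable d : nat.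

Definition last_upset : set 'X_{1..n} :=
  [set m | exists2 i : 'I_n, (n - d <= i)%N & m i != 0%N].

Lemma upset_last : upset last_upset.
Proof.
move=> m m' [i di mi]; exists i => //; rewrite mnmDE addn_eq0.
by rewrite (negPf mi).
Qed.
Definition last_ideal := monomial_ideal upset_last.

(** Written exactly as the ideal inside [last_vars_ideal], so that the latter is the image of
    [lastsum d N] by conversion. *)
Definition lastsum N : ideal R :=
  ideal_gen (N `|` [set 'X_i | i in [set i : 'I_n | (n - d <= i)%N]]).

Lemma lastsumN N : N `<=` lastsum N.
Proof. by move=> f Nf; apply: sub_ideal_gen; left. Qed.

Lemma lastsumX N (i : 'I_n) : (n - d <= i)%N -> lastsum N 'X_i.
Proof. by move=> di; apply: sub_ideal_gen; right; exists i. Qed.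

Lemma last_idealX (i : 'I_n) : (n - d <= i)%N -> last_ideal 'X_i.
Proof. by move=> di; apply/monomial_idealX; exists i => //; rewrite mnm1E eqxx. Qed.

Lemma last_ideal_lastsum N : last_ideal `<=` lastsum N.
Proof.
apply: monomial_ideal_sub => m [i di mi].
rewrite -(@submK _ U_(i) m) ?lep1mP // mpolyXD.
by apply: ideal_memMl; exact: lastsumX.
Qed.

Lemma lastsumP N f :
  lastsum N f <-> exists g h, [/\ N g, last_ideal h & f = g + h].
Proof.
rewrite -ideal_addP; split; last first.
  by apply: ideal_gen_sub => g []; [exact: lastsumN | exact: last_ideal_lastsum].
apply: ideal_gen_sub => g [|[i di <-]]; first exact: ideal_addl.
by apply: ideal_addr; exact: last_idealX.
Qed.

Lemma hclosed_lastsum N : hclosed N -> hclosed (lastsum N).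
Proof.
move=> hN k f /lastsumP[g [h [Ng Lh ->]]]; rewrite raddfD /=; apply: ideal_memD.
  by apply: lastsumN; exact: hN.
by apply: last_ideal_lastsum; exact: (hclosed_monomial_ideal (upU := upset_last)).
Qed.

Lemma size_rev_vars : size (rev_vars K n) = n.
Proof. by rewrite size_rev size_map size_enum_ord. Qed.

Lemma nth_rev_vars (i : 'I_n) : (rev_vars K n)`_i = 'X_(rev_ord i).
Proof.
have := ltn_ord i; rewrite -{2}size_rev_vars size_rev => ni.
rewrite nth_rev // size_map size_enum_ord.
by rewrite (nth_map i) ?size_enum_ord ?subnSK ?leq_subr // (nth_ord_enum i (rev_ord i)).
Qed.

Lemma ideal_add_seq_lastsum N i : (i <= d)%N ->
  ideal_add_seq (rev_vars K n) N i `<=` lastsum N.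
Proof.
elim: i => [_|i IHi id_]; first exact: lastsumN.
apply: ideal_gen_sub => f [|]; first by apply: IHi; exact: ltnW.
apply: ideal_gen_sub => _ ->;
have [ni|ni] := ltnP i n; last first.
  by rewrite nth_default ?size_rev_vars //; exact: (ideal_mem0 (lastsum N)).
rewrite (nth_rev_vars (Ordinal ni)); apply: lastsumX => /=; lia.
Qed.

End GradedIdeals.

(** * Reductions of the irrelevant ideal *)

Lemma mdeg_split n (m : 'X_{1..n}) r : (r <= mdeg m)%N ->
  exists m1 m2, m = (m1 + m2)%MM /\ mdeg m1 = r.
Proof.
elim: r => [|r IHr] rm; first by exists 0%MM, m; rewrite add0m mdeg0.
have [m1 [m2 [mE m1r]]] := IHr (ltnW rm).
have : m2 != 0%MM by rewrite -mdeg_eq0; move: rm; rewrite mE mdegD m1r; lia.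
move=> m20; have [i m2i] : exists i, m2 i != 0%N.
  apply: contrapT => /forallNP m20'; case/eqP: m20; apply/mnmP => i.
  by rewrite mnm0E; have /negP := m20' i; rewrite negbK => /eqP.
exists (m1 + U_(i))%MM, (m2 - U_(i))%MM; rewrite mdegD mdeg1 m1r addn1; split=> //.
by rewrite -addmA [(U_(i) + _)%MM]addmC submK ?lep1mP.
Qed.

(* Ranks are bounded, so a matrix of largest rank among those with rows in V
   has row space V. *)
Lemma subspace_row_space (F : fieldType) c (V : set 'rV[F]_c) :
    V 0 -> (forall a u v, V u -> V v -> V (a *: u + v)) ->
  exists A : 'M[F]_c, forall v, V v <-> (v <= A)%MS.
Proof.
move=> V0 VD.
have Vsum k (u : 'rV_k) (B : 'M_(k, c)) : (forall i, V (row i B)) -> V (u *m B).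
  move=> VB; rewrite mulmx_sum_row; elim/big_ind: _ => // [x y Vx Vy|i _].
    by rewrite -[x]scale1r; exact: VD.
  by rewrite -[_ *: _]addr0; exact: VD.
pose good k := `[< exists A : 'M[F]_c, (forall i, V (row i A)) /\ \rank A = k >].
have goodP : forall k, good k -> (k <= c)%N.
  by move=> k /asboolP[A [_ <-]]; exact: rank_leq_row.
have good0 : exists k, good k.
  exists 0%N; apply/asboolP; exists 0; split; last by rewrite mxrank0.
  by move=> i; rewrite row0.
have [k /asboolP[A [VA rA]] kmax] := ex_maxnP good0 goodP.
exists A => v; split=> [Vv|/submxP[u ->]]; last exact: Vsum.
have AAv : (A <= A + v)%MS by exact: addsmxSl.
have /kmax : good (\rank (A + v)%MS).
  apply/asboolP; exists (A + v)%MS; split=> // i.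
  have /sub_addsmxP[[u w] /= ->] := row_sub i (A + v)%MS.
  rewrite -[_ *m A]scale1r; apply: VD; first exact: Vsum.
  by rewrite -[_ *m v]mulmx1 -mulmxA mulmx1; apply: Vsum => j; rewrite row_id.
rewrite -rA => rAv; have := mxrank_leqif_sup AAv.
move=> [le eq]; have : (\rank A == \rank (A + v)%MS) by rewrite eqn_leq le.
by rewrite eq => Av; exact: submx_trans (addsmxSr A v) Av.
Qed.

Section GradedReductions.
Variables (K : fieldType) (n d : nat).
Local Notation R := {mpoly K[n]}.
Local Notation hpart k := (@pihomog n K mdeg k).
Variable N : ideal R.
Hypotheses (N_hclosed : hclosed N) (N_proper : ~ N 1).
Implicit Types (m : 'X_{1..n}) (f g : R).

Local Notation mm := (irrelevant_ideal N).
Local Notation J := (last_vars_ideal N d).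
Local Notation oideal r := (@order_ideal K n r).

Lemma order_idealX r m : oideal r 'X_[m] <-> (r <= mdeg m)%N.
Proof. exact: monomial_idealX. Qed.

Lemma order_idealM r s f g : oideal r f -> oideal s g -> oideal (r + s) (f * g).
Proof.
move=> fr gs m /msuppM_le/allpairsP[[m1 m2] /= [/fr rm1 /gs sm2 ->]].
by rewrite mdegD; exact: leq_add.
Qed.

Lemma quotient_ideal_mul_sub (A B C : ideal R) (QA QB : ideal (quotient_ring N)) :
    QA `<=` quotient_ideal N A -> QB `<=` quotient_ideal N B ->
    (forall f g, A f -> B g -> C (f * g)) ->
  ideal_mul QA QB `<=` quotient_ideal N C.
Proof.
move=> QAA QBB ABC; apply: ideal_mulS => a b /QAA[f Af <-] /QBB[g Bg <-].
by rewrite -rmorphM; exists (f * g) => //; exact: ABC.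
Qed.

Lemma quotient_ideal_sub (A : ideal R) (Q : ideal (quotient_ring N)) :
  A `<=` preim_ideal Q -> quotient_ideal N A `<=` Q.
Proof. by move=> AQ _ [f Af <-]; exact: AQ. Qed.

Lemma irrelevant_idealE : mm = quotient_ideal N (oideal 1) :> set _.
Proof.
rewrite eqEsubset; split.
  apply: ideal_gen_sub => _ [i _ <-]; exists 'X_i => //.
  by apply/order_idealX; rewrite mdeg1.
apply: quotient_ideal_sub; apply: monomial_ideal_sub => m m1.
have [m' [m'' [-> /eqP/mdeg1P[i /eqP ->]]]] := mdeg_split m1.
rewrite mpolyXD; apply: (ideal_memMr (N := preim_ideal mm)).
by apply: sub_ideal_gen; exists i.
Qed.

Lemma irrelevant_ideal_expE r : ideal_exp mm r = quotient_ideal N (oideal r) :> set _.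
Proof.
rewrite eqEsubset; elim: r => [|r [IH1 IH2]]; split.
- apply: ideal_gen_sub => _ ->; exists 1; last by rewrite rmorph1.
  by move=> m.
- move=> a _; rewrite -[a]mulr1; apply: (ideal_memMl (N := ideal_gen _)).
  exact: sub_ideal_gen.
- apply: (@quotient_ideal_mul_sub (oideal 1) (oideal r)) IH1 _.
    by rewrite irrelevant_idealE.
  by move=> f g; exact: order_idealM.
apply: quotient_ideal_sub; apply: monomial_ideal_sub => m m1.
have [m' [m'' [mE m'r]]] := mdeg_split (ltnW m1).
move: m1; rewrite mE /= mdegD m'r -addn1 leq_add2l => m''1.
rewrite addmC mpolyXD /ideal_mem preim_idealE rmorphM; apply: mem_ideal_mul.
  rewrite /ideal_mem irrelevant_idealE; exists 'X_[m''] => //.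
  exact/order_idealX.
by apply: IH2; exists 'X_[m'] => //; apply/order_idealX; rewrite m'r.
Qed.

Definition linear_part (Q : ideal (quotient_ring N)) : set R :=
  [set l | preim_ideal Q l /\ l \is 1.-homog].

(** Only the linear forms of a reduction matter: up to [N], the rest of [Q] has order at least 2 and
    contributes order at least [r.+2] to the product with the [r]-th power. Taking components of
    degree [r.+1] removes it. *)
Lemma reduction_at_linear_part (Q : ideal (quotient_ring N)) r m :
    homogeneous_ideal (homogeneous_quotient N) Q -> Q `<=` mm ->
    reduction_at mm Q r -> mdeg m = r.+1 ->
  ideal_add N (ideal_gen (linear_part Q)) 'X_[m].
Proof.
move=> Qhom Qm Qred mr; set T := ideal_add _ _.
have NT : N `<=` T by exact: ideal_addl.
have QT : Q `<=` quotient_ideal N (ideal_add T (oideal 2)).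
  rewrite Qhom; apply: ideal_gen_sub => a [Qa [f [k fk] fa]].
  move: Qa; rewrite -fa => Qf.
  exists f => //; have f1 : oideal 1 f.
    apply/(@quotient_idealE _ N) => //; first exact: hclosed_proper.
    by rewrite /ideal_mem -irrelevant_idealE; exact: Qm.
  have [k1|k1] := eqVneq k 1%N.
    apply: ideal_addl; apply: ideal_addr; apply: sub_ideal_gen; split=> //.
    by rewrite -k1.
  apply: ideal_addr => m' m'f /=; have := f1 m' m'f => /=.
  by rewrite (dhomog_mf fk m'f); case: (k) k1 => [|[|]].
have QX : quotient_ideal N (ideal_add T (oideal r.+2)) (quotient_map N 'X_[m]).
  apply: (@quotient_ideal_mul_sub (ideal_add T (oideal 2)) (oideal r) _ Q
            (ideal_exp mm r)) => //.
  - by rewrite irrelevant_ideal_expE.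
  - move=> f g /ideal_addP[f1 [f2 [Tf1 of2 ->]]] og.
    rewrite mulrDl; apply: ideal_memD; first by apply: ideal_addl; exact: ideal_memMr.
    by apply: ideal_addr; rewrite -[r.+2]add2n; exact: order_idealM.
  - rewrite -Qred irrelevant_ideal_expE; exists 'X_[m] => //.
    by apply/order_idealX; rewrite mr.
have : ideal_add T (oideal r.+2) 'X_[m].
  by apply/(@quotient_idealE _ N) => //; exact: subset_trans NT (@ideal_addl _ _ _).
move=> /ideal_addP[t [o [Tt oo XE]]].
have -> : 'X_[m] = hpart r.+1 t.
  have := congr1 (hpart r.+1) XE; rewrite raddfD /= pihomogX /= mr eqxx => ->.
  rewrite -[RHS]addr0; congr (_ + _); apply/mpolyP => m'; rewrite mcoeff0.
  apply/eqP; rewrite mcoeff_eq0 msupp_hpart; apply/negP => /andP[/eqP m'r /oo /=].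
  by rewrite m'r ltnn.
move: Tt => /ideal_addP[g [h [Ng Lh ->]]]; rewrite raddfD /=; apply: ideal_memD.
  by apply: ideal_addl; exact: N_hclosed.
apply: ideal_addr; apply: hclosed_gen Lh => k s [Qs s1].
have [<-|ne] := eqVneq 1%N k; first by rewrite pihomog_dE //; exact: sub_ideal_gen.
by rewrite (pihomog_ne0 ne) //; exact: ideal_mem0.
Qed.

Lemma last_vars_ideal_sub : J `<=` mm.
Proof.
rewrite irrelevant_idealE => _ [f Jf <-]; exists f => //.
suff : lastsum d N `<=` oideal 1 by apply.
apply: ideal_gen_sub => g [/(hclosed_proper N_hclosed N_proper)//|[i _ <-]].
by apply/order_idealX; rewrite mdeg1.
Qed.

Lemma last_vars_ideal_homogeneous :
  homogeneous_ideal (homogeneous_quotient N) J.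
Proof. exact: quotient_ideal_homogeneous (hclosed_lastsum N_hclosed). Qed.

(** Forwards, the linear part of [J] lies in [lastsum d N]. Backwards, modulo [N] a monomial of
    degree [r.+1] is a combination of monomials of that degree divisible by one of the last [d]
    variables, with cofactor of degree [r]. *)
Lemma reduction_at_last_vars r : reduction_at mm J r <->
  forall m, mdeg m = r.+1 -> lastsum d N 'X_[m].
Proof.
split=> [Jred m mr|lastX].
  have := reduction_at_linear_part last_vars_ideal_homogeneous
    last_vars_ideal_sub Jred mr.
  apply: ideal_gen_sub => f [|]; first exact: lastsumN.
  apply: ideal_gen_sub => l [+ _].
  by move=> /(@quotient_idealE _ N); apply; exact: lastsumN.
rewrite /reduction_at eqEsubset; split; last first.
  by apply: ideal_mulS => a b /last_vars_ideal_sub ma mb; exact: mem_ideal_mul.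
rewrite irrelevant_ideal_expE; set Q := ideal_mul _ _.
have lastQ m : mdeg m = r.+1 -> last_upset d m -> preim_ideal Q 'X_[m].
  move=> mr [i di mi]; rewrite -(@submK _ U_(i) m) ?lep1mP // addmC mpolyXD.
  rewrite /ideal_mem preim_idealE rmorphM; apply: mem_ideal_mul.
    by exists 'X_i => //; exact: lastsumX.
  rewrite /ideal_mem irrelevant_ideal_expE; exists 'X_[m - U_(i)] => //.
  apply/order_idealX; suff : (mdeg (m - U_(i))).+1 = r.+1 by case=> ->.
  by rewrite -addn1 -(mdeg1 i) -mdegD submK // lep1mP.
apply: quotient_ideal_sub; apply: monomial_ideal_sub => m rm.
have [m1 [m2 [-> m1r]]] := mdeg_split rm.
rewrite mpolyXD; apply: (ideal_memMr (N := preim_ideal Q)).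
have /lastsumP[g [h [Ng Lh XE]]] := lastX m1 m1r.
have := congr1 (hpart r.+1) XE; rewrite raddfD /= pihomogX /= m1r eqxx => ->.
apply: ideal_memD.
  by apply: preim_ideal_sub; exact: N_hclosed.
rewrite [hpart _ _]mpolyE big_seq_cond; apply: ideal_mem_sum => m'.
rewrite andbT msupp_hpart => /andP[/eqP m'r m'h].
by apply: ideal_memZ; apply: lastQ => //; exact: Lh.
Qed.

Lemma lastsum_nilpotent :
    (forall i : 'I_n, exists k, lastsum d N ('X_i ^+ k)) ->
  exists r, forall m, mdeg m = r.+1 -> lastsum d N 'X_[m].
Proof.
move=> nilp; have {nilp} /choice[k nilk] := nilp.
(* Pigeonhole: in degree [n * b + 1] some exponent exceeds [b], which is at least every [k i]. *)
pose b := (\sum_i k i)%N; exists (n * b)%N => m mr.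
have [i bi] : exists i, (b < m i)%N.
  apply: contrapT => /forallNP mb; suff : (mdeg m <= n * b)%N by rewrite mr ltnn.
  have -> : (n * b = \sum_(i < n) b)%N by rewrite sum_nat_const card_ord.
  rewrite mdegE; apply: leq_sum => i _.
  by have /negP := mb i; rewrite -leqNgt.
rewrite mpolyXE_id (bigD1 i) //=; apply: ideal_memMr.
rewrite -(@subnK (k i) (m i)); last first.
  by apply: leq_trans (ltnW bi); rewrite /b (bigD1 i) //=; exact: leq_addr.
by rewrite exprD; exact: ideal_memMl.
Qed.

(** The dimension enters only through the second hypothesis, so the lemma serves both [I] and its
    initial ideal. For a reduction [Q] inside [J], the combinations of the last variables lying in
    [Q] form a subspace of [K^d]; a basis of it generates enough to force dimension [d], so [Q]
    contains all these variables. *)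
Lemma last_vars_minimal_reduction :
    (exists r, reduction_at mm J r) ->
    (forall k r (l : 'I_k -> R), (forall j, l j \is 1.-homog) ->
       (forall m, mdeg m = r.+1 -> ideal_add N (ideal_gen (range l)) 'X_[m]) ->
     (d <= k)%N) ->
  is_minimal_reduction (homogeneous_quotient N) mm J.
Proof.
move=> Jred growth; split.
  split=> //; [exact: last_vars_ideal_homogeneous | exact: last_vars_ideal_sub].
move=> Q [Qhom Qm [r Qred]] QJ.
rewrite eqEsubset; split=> //.
(* For [j >= n] this is the default 0, which is harmless since 0 counts as a linear form. *)
pose y (j : 'I_d) : R := (rev_vars K n)`_j.
pose form (v : 'rV[K]_d) : R := \sum_j v 0 j *: y j.
have formD a u v : form (a *: u + v) = a *: form u + form v.
  rewrite /form scaler_sumr -big_split /=; apply: eq_bigr => j _.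
  by rewrite !mxE scalerDl scalerA.
have form0 : form 0 = 0.
  by rewrite /form big1 // => j _; rewrite mxE scale0r.
have form_delta j : form (delta_mx 0 j) = y j.
  rewrite /form (bigD1 j) //= big1 ?addr0 ?mxE ?eqxx ?scale1r // => j' ne.
  by rewrite mxE eqxx /= (negPf ne) scale0r.
have yX j : y j = 0 \/ exists2 i : 'I_n, (n - d <= i)%N & y j = 'X_i.
  have [nj|nj] := ltnP j n; last by left; rewrite /y nth_default ?size_rev_vars.
  right; exists (rev_ord (Ordinal nj)); first by have := ltn_ord j; rewrite /=; lia.
  exact: (nth_rev_vars K (Ordinal nj)).
have Xy (i : 'I_n) : (n - d <= i)%N -> exists j, y j = 'X_i.
  move=> di; have jd : (rev_ord i < d)%N by have := ltn_ord i; rewrite /=; lia.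
  by exists (Ordinal jd); rewrite /y nth_rev_vars rev_ordK.
have y1 j : y j \is 1.-homog.
  have [->|[i _ ->]] := yX j; first exact: dhomog0.
  by rewrite dhomogX /= mdeg1.
have form1 v : form v \is 1.-homog.
  by apply: rpred_sum => j _; apply: rpredZ.
have [|a u v Vu Vv|A VA] := @subspace_row_space K d [set v | preim_ideal Q (form v)].
- by rewrite /= form0; exact: ideal_mem0.
- by rewrite /= formD; apply: ideal_memD => //; exact: ideal_memZ.
have [rA|rA] := eqVneq (\rank A) d.
  apply: quotient_ideal_sub; apply: ideal_gen_sub => f [|[i di <-]].
    exact: preim_ideal_sub.
  have [j <-] := Xy i di.
  by rewrite -form_delta; apply/VA; apply: submx_full; rewrite /row_full rA.
have : (d <= \rank A)%N; last first.
  by have := rank_leq_row A => le1 le2; case/eqP: rA; apply/eqP; rewrite eqn_leq le1.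
apply: (growth _ r (fun j => form (row j (row_base A)))) => // m mr.
have := reduction_at_linear_part Qhom Qm Qred mr.
set T := ideal_add _ _ ; set T' := ideal_add _ _.
apply: ideal_gen_sub => f [|]; first exact: ideal_addl.
apply: ideal_gen_sub => l [Ql l1].
have formT v : (v <= A)%MS -> T' (form v).
  rewrite -(eq_row_base A) => /submxP[u ->]; rewrite mulmx_sum_row.
  elim/big_rec: _ => [|j v' _ Tv']; first by rewrite form0; exact: ideal_mem0.
  rewrite formD; apply: ideal_memD => //; apply: ideal_memZ; apply: ideal_addr.
  by apply: sub_ideal_gen; exists j.
(* the degree one part of l is a form modulo N, since Q is contained in J *)
have /lastsumP[g [h [Ng Lh lE]]] : lastsum d N l.
  by apply/(@quotient_idealE _ N); [exact: lastsumN | exact: QJ].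
have {lE} lE : l = hpart 1 g + hpart 1 h.
  by rewrite -raddfD -lE /= pihomog_dE.
have [v hv] : exists v, hpart 1 h = form v.
  rewrite [hpart _ _]mpolyE big_seq_cond.
  elim/big_rec: _ => [|m' f']; first by exists 0; rewrite form0.
  rewrite andbT msupp_hpart => /andP[/mdeg1P[i /eqP m'i] m'h] [v ->].
  have [i' di' m'i'] := Lh _ m'h; have : (n - d <= i)%N.
    by move: m'i'; rewrite m'i mnm1E eqb0 negbK => /eqP ->.
  move=> /Xy[j yj]; exists ((hpart 1 h)@_m' *: delta_mx 0 j + v).
  by rewrite formD form_delta yj m'i.
have Ng1 : N (hpart 1 g) by exact: N_hclosed.
rewrite lE; apply: ideal_memD; first exact: ideal_addl.
rewrite hv; apply: formT; apply/VA => /=; rewrite -hv.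
have -> : hpart 1 h = l - hpart 1 g by rewrite lE addrC addKr.
by apply: ideal_memB => //; exact: preim_ideal_sub.
Qed.

End GradedReductions.

(** * Growth of graded quotients and chains of primes *)

Lemma linear_dependence (K : fieldType) (G F : finType) (c : G -> F -> K) :
    (#|F| < #|G|)%N ->
  exists u : G -> K, (exists g, u g != 0) /\ forall f, \sum_g u g * c g f = 0.
Proof.
move=> FG; pose C := \matrix_(i < #|G|, j < #|F|) c (enum_val i) (enum_val j).
have [i0 ui0] : exists i, row i (kermx C) != 0.
  apply: contrapT => /forallNP kC0; suff : (\rank (kermx C) == 0)%N.
    rewrite mxrank_ker subn_eq0 leqNgt => /negP; apply.
    exact: leq_ltn_trans (rank_leq_col C) FG.
  rewrite mxrank_eq0; apply/eqP/row_matrixP => i; rewrite row0.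
  by have /negP := kC0 i; rewrite negbK => /eqP.
have [v [v_neq0 vC]] : exists v : 'rV_#|G|, v != 0 /\ v *m C = 0.
  by exists (row i0 (kermx C)); split=> //; apply/sub_kermxP; exact: row_sub.
exists (fun g => v 0 (enum_rank g)); split.
  apply: contrapT => /forallNP v0; case/eqP: v_neq0; apply/rowP => j; rewrite [RHS]mxE.
  by have /negP := v0 (enum_val j); rewrite enum_valK negbK => /eqP.
move=> f; have vCf : (v *m C) 0 (enum_rank f) = 0 by rewrite vC mxE.
rewrite -[RHS]vCf mxE (reindex (@enum_val G predT)); last first.
  by apply: onW_bij; exact: enum_val_bij.
by apply: eq_bigr => i _; rewrite mxE enum_valK enum_rankK.
Qed.

Section SpanModulo.
Variables (K : fieldType) (n : nat).
Local Notation R := {mpoly K[n]}.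
Local Notation hpart k := (@pihomog n K mdeg k).
Implicit Types (I N : ideal R) (F G : finType).

Definition span_mod N F (e : F -> R) : set R :=
  [set f | exists c : F -> K, N (f - \sum_i c i *: e i)].

Lemma span_mod_basis N F (e : F -> R) i : span_mod N e (e i).
Proof.
exists (fun j => (j == i)%:R); rewrite (bigD1 i) //= eqxx scale1r big1 ?addr0.
  by rewrite subrr; exact: ideal_mem0.
by move=> j /negPf ->; rewrite scale0r.
Qed.

Lemma span_mod_ideal N F (e : F -> R) f : N f -> span_mod N e f.
Proof.
by move=> Nf; exists (fun=> 0); rewrite big1 ?subr0 // => i _; rewrite scale0r.
Qed.

Lemma span_modP N F (e : F -> R) a f g :
  span_mod N e f -> span_mod N e g -> span_mod N e (a *: f + g).
Proof.
move=> [c Nc] [b Nb]; exists (fun i => a * c i + b i).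
under eq_bigr do rewrite scalerDl -scalerA.
rewrite big_split /= -scaler_sumr opprD addrACA -scalerBr.
by apply: ideal_memD => //; exact: ideal_memZ.
Qed.

Lemma span_mod_sum N F (e : F -> R) (T : eqType) (r : seq T) (a : T -> K) (g : T -> R) :
    (forall i, i \in r -> span_mod N e (g i)) ->
  span_mod N e (\sum_(i <- r) a i *: g i).
Proof.
elim: r => [|i r IHr] eg.
  by rewrite big_nil; apply: span_mod_ideal; exact: ideal_mem0.
rewrite big_cons; apply: span_modP; first by apply: eg; exact: mem_head.
by apply: IHr => j jr; apply: eg; rewrite inE jr orbT.
Qed.

Lemma span_mod_msupp N F (e : F -> R) f :
  (forall m, m \in msupp f -> span_mod N e 'X_[m]) -> span_mod N e f.
Proof. by move=> ef; rewrite [f]mpolyE; exact: span_mod_sum. Qed.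

Lemma span_mod_sub N F (e : F -> R) (P : set R) :
    (forall f, N f -> P f) -> (forall a f g, P f -> P g -> P (a *: f + g)) ->
    (forall i, P (e i)) ->
  span_mod N e `<=` P.
Proof.
move=> NP PD eP f [c Nf].
have Psum : P (\sum_i c i *: e i).
  by elim/big_rec: _ => [|i g _ Pg]; [exact/NP/ideal_mem0 | exact: PD].
by rewrite -(subrK (\sum_i c i *: e i) f) -[f - _]scale1r; apply: PD => //; exact: NP.
Qed.

Lemma span_mod_dependent N F (e : F -> R) G (p : G -> R) :
    (#|F| < #|G|)%N -> (forall g, span_mod N e (p g)) ->
  exists u : G -> K, (exists g, u g != 0) /\ N (\sum_g u g *: p g).
Proof.
move=> FG /choice[c Nc]; have [u [u0 uc]] := linear_dependence c FG.
exists u; split=> //.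
have -> : \sum_g u g *: p g = \sum_g u g *: (p g - \sum_i c g i *: e i).
  under [RHS]eq_bigr do rewrite scalerBr.
  rewrite sumrB [X in _ - X](_ : _ = 0) ?subr0 //.
  under eq_bigr do rewrite scaler_sumr.
  rewrite exchange_big big1 //= => i _.
  under eq_bigr do rewrite scalerA.
  by rewrite -scaler_suml uc scale0r.
by apply: ideal_mem_sum => g _; exact: ideal_memZ.
Qed.

Lemma hpartM_linear k (q l : R) : l \is 1.-homog ->
  hpart k.+1 (q * l) = hpart k q * l.
Proof.
move=> l1; elim/mpolyind: q => [|c m q _ _ IHq]; first by rewrite mul0r !raddf0 mul0r.
rewrite mulrDl raddfD /= IHq -scalerAl linearZ /= hpartXM.
rewrite linearP /= pihomogX /= mulrDl -scalerAl; congr (_ *: _ + _).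
have [mk|mk] := eqVneq (mdeg m) k.
  by rewrite mk leqnSn subSnn pihomog_dE.
case: leqP => mk1; rewrite mul0r // (pihomog_ne0 _ l1) ?mulr0 //.
by apply/eqP; move/eqP: mk; lia.
Qed.

(** A bound of order [T^k] on the dimension of the part of [R / N] of degree at most [T], expressed
    by a finite spanning family; [msize f <= T.+1] says that [f] has degree at most [T]. *)
Definition polynomial_growth N k := exists B, forall T,
  exists (F : finType) (e : F -> R), (#|F| <= B * T.+1 ^ k)%N /\
    forall f, (msize f <= T.+1)%N -> span_mod N e f.

Section LinearQuotient.
Variables (N : ideal R) (k r : nat) (l : 'I_k -> R).
Hypotheses (N_hclosed : hclosed N) (l1 : forall j, l j \is 1.-homog).
Hypothesis lX : forall m, mdeg m = r.+1 ->
  ideal_add N (ideal_gen (range l)) 'X_[m].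

(** The first factor is a monomial of degree at most [r], the second a monomial in the forms [l j]
    with exponents at most [T]. The number of such products is a constant times [T.+1 ^ k]. *)
Definition linear_basis T (i : 'X_{1..n < r.+1} * {ffun 'I_k -> 'I_T.+1}) : R :=
  'X_[i.1] * \prod_j l j ^+ i.2 j.

Lemma linear_basisM T j : span_mod N (@linear_basis T) `<=`
  [set f | span_mod N (@linear_basis T.+1) (f * l j)].
Proof.
apply: span_mod_sub => [f Nf|a f g Sf Sg|[b al]] /=.
- by apply: span_mod_ideal; exact: ideal_memMr.
- by rewrite mulrDl -scalerAl; exact: span_modP.
pose al' := [ffun i => inord (al i + (i == j))] : {ffun 'I_k -> 'I_T.+2}.
have -> : linear_basis (b, al) * l j = linear_basis (b, al'); last first.
  exact: span_mod_basis.
rewrite /linear_basis /= -mulrA; congr (_ * _).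
rewrite (bigD1 j) //= [RHS](bigD1 j) //= mulrAC -exprSr ffunE eqxx addn1.
rewrite inordK ?ltnS; last by have := ltn_ord (al j); rewrite ltnS.
congr (_ * _); apply: eq_bigr => i /negPf ij; rewrite ffunE ij addn0 inordK //.
by apply: leq_trans (ltn_ord _) _; exact: leqnSn.
Qed.

Lemma linear_basis_widen T T' : (T <= T')%N ->
  span_mod N (@linear_basis T) `<=` span_mod N (@linear_basis T').
Proof.
move=> TT'; apply: span_mod_sub => [f|a f g|[b al]].
- exact: span_mod_ideal.
- exact: span_modP.
have -> : linear_basis (b, al) =
    linear_basis (b, [ffun i => widen_ord (TT' : (T < T'.+1)%N) (al i)]).
  by rewrite /linear_basis; congr (_ * _); apply: eq_bigr => i _; rewrite ffunE.
exact: span_mod_basis.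
Qed.

(** Strong induction on the degree. A factor of degree [r.+1] is rewritten modulo [N] as a sum of
    terms [q j * l j] with [q j] homogeneous of degree [r]; the remaining cofactor of [l j] has
    degree one less than [m], and multiplying it by [l j] raises the exponent bound by exactly
    one. *)
Lemma span_linear_basisX m : span_mod N (@linear_basis (mdeg m)) 'X_[m].
Proof.
have [s] := ubnP (mdeg m); elim: s m => // s IHs m; rewrite ltnS => ms.
have [mr|mr] := leqP (mdeg m) r.
  have -> : 'X_[m] = linear_basis
      (BMultinom (mr : (mdeg m < r.+1)%N), [ffun=> ord0 : 'I_(mdeg m).+1]).
    by rewrite /linear_basis big1 ?mulr1 // => j _; rewrite ffunE expr0.
  exact: span_mod_basis.
have [m1 [m2 [mE m1r]]] := mdeg_split mr.
have mdE : mdeg m = (mdeg m2 + r).+1 by rewrite mE mdegD m1r addnC addnS.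
have /ideal_addP[g [h [Ng lh XE]]] := lX m1r.
have [q hE] : exists q, h = \sum_j q j * l j.
  suff idT : is_ideal [set h | exists q, h = \sum_j q j * l j].
    apply: (@ideal_gen_sub _ _ (Ideal idT)) lh => _ [j _ <-].
    exists (fun i => (i == j)%:R); rewrite (bigD1 j) //= eqxx mul1r.
    by rewrite big1 ?addr0 // => i /negPf ->; rewrite mul0r.
  split; first by exists (fun=> 0); rewrite big1 // => i _; rewrite mul0r.
  move=> a _ _ [q ->] [q' ->]; exists (fun j => a * q j + q' j).
  by rewrite mulr_sumr -big_split /=; apply: eq_bigr => j _; rewrite mulrDl mulrA.
have -> : 'X_[m] = 'X_[m2] * hpart r.+1 g +
    \sum_j 1 *: ('X_[m2] * hpart r (q j) * l j).
  rewrite mE addmC mpolyXD.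
  have := congr1 (hpart r.+1) XE; rewrite raddfD /= pihomogX /= m1r eqxx => ->.
  rewrite mulrDr hE raddf_sum /=; congr (_ + _).
  by rewrite mulr_sumr; apply: eq_bigr => j _; rewrite scale1r -mulrA hpartM_linear.
rewrite -[_ * hpart r.+1 g]scale1r; apply: span_modP.
  by apply: span_mod_ideal; apply: ideal_memMl; exact: N_hclosed.
apply: span_mod_sum => j _; rewrite mdE; apply: linear_basisM.
apply: span_mod_msupp => m' /msuppM_le/allpairsP[[n1 n2] /= []].
rewrite msuppX mem_seq1 => /eqP ->; rewrite msupp_hpart => /andP[/eqP n2r _] m'E.
have m'd : mdeg m' = (mdeg m2 + r)%N by rewrite m'E mdegD n2r.
by rewrite -m'd; apply: IHs; rewrite m'd; lia.
Qed.

Lemma linear_quotient_growth : polynomial_growth N k.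
Proof.
exists #|{: 'X_{1..n < r.+1}}| => T; exists _, (@linear_basis T); split.
  by rewrite card_prod card_ffun !card_ord.
move=> f fT; apply: span_mod_msupp => m mf.
apply: (@linear_basis_widen (mdeg m)); last exact: span_linear_basisX.
by rewrite -ltnS; exact: leq_trans (msize_mdeg_lt mf) fT.
Qed.

End LinearQuotient.

(* Elements f_i of P_(i+1) outside P_i are algebraically independent over K:
   divide a relation by the largest power of f_0, and reduce it modulo f_0. *)
Section ChainIndependent.
Variables (P : nat -> ideal R) (e t : nat) (f : nat -> R).
Hypothesis P_prime : forall i, (i <= e)%N -> prime_ideal (P i).
Hypothesis P_sub : forall i, (i < e)%N -> P i `<=` P i.+1.
Hypothesis fP : forall i, (i < e)%N -> P i.+1 (f i).
Hypothesis fNP : forall i, (i < e)%N -> ~ P i (f i).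
Local Notation G := {ffun 'I_e -> 'I_t.+1}.
Variable u : G -> K.

Lemma prime_ideal_exp (Q : ideal R) x b : prime_ideal Q -> ~ Q x -> ~ Q (x ^+ b).
Proof.
move=> [Q1 QM] Qx; elim: b => [|b IHb]; first by rewrite expr0.
by rewrite exprS => /QM[].
Qed.

(** Induction on [e - j]. The exponents in [A] agree below position [j], and the corresponding
    powers have been dropped from the products; at [j = e] a single exponent is left and the sum is
    a nonzero constant, which no prime contains. *)
Lemma chain_independent_step j (A : {set G}) : (j <= e)%N -> A != finset.set0 ->
    (forall be, be \in A -> u be != 0) ->
    (forall be ga, be \in A -> ga \in A -> forall i : 'I_e, (i < j)%N -> be i = ga i) ->
  ~ P j (\sum_(be in A) u be *: \prod_(i < e | (j <= i)%N) f i ^+ be i).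
Proof.
move=> je; have [k ek] : exists k, (e - j)%N = k by exists (e - j)%N.
elim: k j je ek A => [|k IHk] j je ek A /finset.set0Pn[be0 A0] uA Aj.
  have ej : e = j by lia.
  have -> : A = finset.set1 be0.
    apply/finset.setP => be; rewrite finset.in_set1; apply/idP/eqP => [Abe|-> //].
    by apply/ffunP => i; apply: (Aj _ _ Abe A0); rewrite -ej.
  rewrite finset.big_set1 big_pred0 => [Pu|i]; last by rewrite -ej leqNgt ltn_ord.
  apply: (P_prime je).1; have -> : 1 = (u be0)^-1 *: (u be0 *: 1) :> R.
    by rewrite scalerA mulVf ?scale1r // uA.
  exact: ideal_memZ.
have jlt : (j < e)%N by lia.
pose oj := Ordinal jlt.
pose b := [arg min_(be < be0 in A) (be oj : nat)].
have [Ab bmin] : b \in A /\ forall be, be \in A -> (b oj <= be oj)%N.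
  by rewrite /b; case: arg_minnP.
pose tail (be : G) := \prod_(i < e | (j < i)%N) f i ^+ be i.
have tailE (be : G) : \prod_(i < e | (j <= i)%N) f i ^+ be i = f j ^+ be oj * tail be.
  rewrite (bigD1 oj) //=; congr (_ * _); apply: eq_bigl => i.
  by rewrite ltn_neqAle andbC eq_sym.
pose inner := \sum_(be in A) u be *: (f j ^+ (be oj - b oj) * tail be).
have -> : \sum_(be in A) u be *: \prod_(i < e | (j <= i)%N) f i ^+ be i =
    f j ^+ b oj * inner.
  rewrite mulr_sumr; apply: eq_bigr => be Abe.
  by rewrite tailE -scalerAr mulrA -exprD subnKC ?bmin.
move=> /(P_prime je).2[|/(P_sub jlt)]; first exact: prime_ideal_exp (P_prime je) (fNP jlt).
(* After cancelling the least power of [f j], the terms outside [A'] are still divisible by [f j]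
   and so vanish modulo [P j.+1]. *)
pose A' := finset (fun be => (be \in A) && (be oj == b oj)).
rewrite /inner (bigID (fun be : G => be oj == b oj)) /= => Psum.
apply: (IHk j.+1 jlt _ A'); first by lia.
- by apply/finset.set0Pn; exists b; rewrite finset.in_set Ab eqxx.
- by move=> be; rewrite finset.in_set => /andP[/uA].
- move=> be ga; rewrite !finset.in_set => /andP[Abe /eqP be_b] /andP[Aga /eqP ga_b] i.
  rewrite ltnS leq_eqVlt => /orP[/eqP ij|]; last exact: Aj.
  have -> : i = oj; first exact: val_inj.
  by rewrite be_b ga_b.
move: Psum; set S1 := \sum_(be | _) _; set S2 := \sum_(be | _ && ~~ _) _ => Psum.
have -> : \sum_(be in A') u be *: \prod_(i < e | (j < i)%N) f i ^+ be i = S1 + S2 - S2.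
  rewrite addrK; apply: eq_big => [be|be]; rewrite finset.in_set // => /andP[_ /eqP ->].
  by rewrite subnn expr0 mul1r.
apply: ideal_memB => //; apply: ideal_mem_sum => be /andP[Abe be_b].
apply: ideal_memZ; apply: ideal_memMr.
have : (0 < be oj - b oj)%N by rewrite subn_gt0 ltn_neqAle eq_sym be_b bmin.
by case: (_ - _)%N => // c _; rewrite exprS; apply: ideal_memMr; exact: fP.
Qed.

Lemma chain_independent :
  P 0%N (\sum_be u be *: \prod_(i < e) f i ^+ be i) -> forall be, u be = 0.
Proof.
move=> P0 be; apply/eqP; apply: contrapT => /negP ube.
pose A := finset (fun be => u be != 0).
apply: (@chain_independent_step 0 A) => //.
- by apply/finset.set0Pn; exists be; rewrite finset.in_set.
- by move=> ga; rewrite finset.in_set.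
have -> : \sum_(be in A) u be *: \prod_(i < e | (0 <= i)%N) f i ^+ be i =
    \sum_be u be *: \prod_(i < e) f i ^+ be i.
  rewrite big_mkcond /=; apply: eq_bigr => ga _; rewrite finset.in_set.
  by case: eqVneq => [->|//]; rewrite scale0r.
exact: P0.
Qed.

End ChainIndependent.

Lemma msize_mul_le (p q : R) a b : (msize p <= a.+1)%N -> (msize q <= b.+1)%N ->
  (msize (p * q) <= (a + b).+1)%N.
Proof.
have [->|p0] := eqVneq p 0; first by rewrite mul0r msize0.
have [->|q0] := eqVneq q 0; first by rewrite mulr0 msize0.
move=> pa qb; rewrite msizeM_proper; last first.
  by rewrite mulf_neq0 // -mcoeff_msupp mlead_supp.
by have := leq_add pa qb; rewrite addSn addnS; lia.
Qed.

Lemma msize_exp_le (f : R) a b : (msize f <= a.+1)%N -> (msize (f ^+ b) <= (b * a).+1)%N.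
Proof.
move=> fa; elim: b => [|b IHb]; first by rewrite expr0 msize1.
by rewrite exprS mulSn; exact: msize_mul_le.
Qed.

(** If [k < e], the products of powers of the chain elements with exponents at most [t] outnumber a
    spanning family in their degree range, and the resulting relation contradicts
    [chain_independent]. *)
Lemma prime_chain_growth I k e :
  polynomial_growth I k -> prime_chain (quotient_ring I) e -> (e <= k)%N.
Proof.
move=> [B growth] /prime_chain_preim[P [IP Pprime Plt]].
rewrite leqNgt; apply/negP => ke.
have /choice[f fP] : forall i, exists f, (i < e)%N -> P i.+1 f /\ ~ P i f.
  move=> i; have [ie|] := boolP (i < e)%N; last by exists 0.
  by have [_ /existsNP[f /not_implyP[]]] := Plt i ie; exists f.
pose D := (\sum_(i < e) msize (f i))%N.
(* With this choice [B * (e * (t * D)).+1 ^ k] is at most [B * ((e * D).+1 * t.+1) ^ k = t * t.+1 ^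
   k], which is smaller than [t.+1 ^ k.+1], hence than the number [t.+1 ^ e] of products. *)
pose t := (B * (e * D).+1 ^ k)%N.
have [F [g [cardF spanF]]] := growth (e * (t * D))%N.
pose p (be : {ffun 'I_e -> 'I_t.+1}) : R := \prod_(i < e) f i ^+ be i.
have FG : (#|F| < #|{: {ffun 'I_e -> 'I_t.+1}}|)%N.
  rewrite card_ffun !card_ord; apply: leq_ltn_trans cardF _.
  have le1 : ((e * (t * D)).+1 <= (e * D).+1 * t.+1)%N by nia.
  have le2 : (t.+1 ^ k.+1 <= t.+1 ^ e)%N by rewrite leq_pexp2l.
  apply: leq_trans le2; rewrite expnS mulSn.
  apply: (@leq_ltn_trans (B * ((e * D).+1 * t.+1) ^ k)).
    rewrite leq_mul2l; case: (k) => [|k']; first by rewrite !expn0 orbT.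
    by rewrite leq_exp2r ?le1 ?orbT.
  by rewrite expnMn mulnA -/t -addn1 addnC leq_add2r expn_gt0.
have [be|u [[be ube] Iu]] := @span_mod_dependent I F g _ p FG.
  apply: spanF; rewrite /p.
  suff : (msize (\prod_(i < e) f i ^+ be i) <= (\sum_(i < e) t * D).+1)%N.
    by rewrite sum_nat_const card_ord.
  elim/big_rec2: _ => [|i a q _ qa]; first by rewrite msize1.
  have fD : (msize (f i) <= D.+1)%N.
    by apply: leqW; rewrite /D (bigD1 i) //=; exact: leq_addr.
  apply: msize_mul_le => //; apply: leq_trans (msize_exp_le (be i) fD) _.
  by rewrite ltnS leq_mul2r -ltnS ltn_ord orbT.
case/eqP: ube; apply: (@chain_independent P e t f) be => //.
- by move=> i ie; exact: (Plt i ie).1.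
- by move=> i /fP[].
- by move=> i /fP[].
exact: IP.
Qed.

End SpanModulo.

(** * The reverse lexicographic initial ideal *)

Section RevLex.
Variable n : nat.
Implicit Types m : 'X_{1..n}.

Lemma revlex_irr m : ~ revlex_lt m m.
Proof. by case=> [|[_ [i [+ _]]]]; rewrite ltnn. Qed.

Lemma revlex_mdeg m1 m2 : revlex_lt m1 m2 -> (mdeg m1 <= mdeg m2)%N.
Proof. by case=> [/ltnW|[->]]. Qed.

Lemma revlex_trans m2 m1 m3 :
  revlex_lt m1 m2 -> revlex_lt m2 m3 -> revlex_lt m1 m3.
Proof.
move=> [d12|[d12 [i [lt12 eq12]]]] [d23|[d23 [j [lt23 eq23]]]].
- by left; exact: ltn_trans d23.
- by left; rewrite -d23.
- by left; rewrite d12.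
right; split; first by rewrite d12.
have [ij|ji|/val_inj ij] := ltngtP i j.
- exists j; rewrite eq12 //; split=> // k jk.
  by rewrite eq12 ?eq23 //; exact: ltn_trans ij jk.
- exists i; rewrite -eq23 //; split=> // k ik.
  by rewrite eq12 ?eq23 //; exact: ltn_trans ji ik.
exists i; split; first by rewrite -ij in lt23; exact: ltn_trans lt23 lt12.
by move=> k ik; rewrite eq12 ?eq23 // -ij.
Qed.

Lemma revlex_add m m1 m2 : revlex_lt m1 m2 -> revlex_lt (m1 + m)%MM (m2 + m)%MM.
Proof.
move=> [d12|[d12 [i [lt12 eq12]]]]; first by left; rewrite !mdegD ltn_add2r.
right; split; first by rewrite !mdegD d12.
exists i; rewrite !mnmDE ltn_add2r; split=> // j ij.
by rewrite !mnmDE eq12.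
Qed.

(** Smaller monomials have no larger degree, so only finitely many lie below a given one; the
    induction is on their number. *)
Lemma revlex_ind (P : 'X_{1..n} -> Prop) :
  (forall m, (forall m', revlex_lt m' m -> P m') -> P m) -> forall m, P m.
Proof.
move=> IH m0; pose T := mdeg m0.
pose low m := finset (fun x : 'X_{1..n < T.+1} => `[< revlex_lt x m >]).
suff : forall m, (mdeg m <= T)%N -> P m by apply.
move=> m; have [c] := ubnP #|low m|; elim: c m => // c IHc m; rewrite ltnS => lowm mT.
apply: IH => m' m'm; have m'T : (mdeg m' < T.+1)%N.
  by rewrite ltnS; exact: leq_trans (revlex_mdeg m'm) mT.
apply: IHc => //; apply: leq_trans lowm; apply: proper_card.
apply/properP; split.
  apply/fintype.subsetP => x; rewrite !finset.in_set => /asboolP xm'.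
  by apply/asboolP; exact: revlex_trans m'm.
exists (BMultinom m'T); rewrite finset.in_set; first exact/asboolP.
by apply/asboolP; exact: revlex_irr.
Qed.

(** The largest index where the exponents differ is at least [i0], hence among the last [d], where
    [m2] vanishes and [m1] must be positive. *)
Lemma revlex_last d m1 m2 :
  mdeg m1 = mdeg m2 -> last_upset d m1 -> ~ last_upset d m2 -> revlex_lt m1 m2.
Proof.
move=> deg12 [i0 di0 m1i0] nm2; right; split=> //.
have m2i (i : 'I_n) : (n - d <= i)%N -> m2 i = 0%N.
  by move=> di; apply: contrapT => /eqP m2i; apply: nm2; exists i.
have Pi0 : m1 i0 != m2 i0 by rewrite m2i.
have [i m12i imax] := arg_maxnP (P := fun i => m1 i != m2 i) (fun i => i : nat) Pi0.
exists i; split.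
  have di : (n - d <= i)%N by exact: leq_trans di0 (imax _ Pi0).
  by rewrite m2i // lt0n -(m2i i).
move=> j ij; apply/eqP; apply: contraTT ij => /imax.
by rewrite -leqNgt.
Qed.

End RevLex.

(** * Comparison of a homogeneous ideal with its initial ideal *)

Section InitialIdeal.
Variables (K : fieldType) (n d : nat).
Local Notation R := {mpoly K[n]}.
Local Notation hpart k := (@pihomog n K mdeg k).
Implicit Types (m : 'X_{1..n}) (f g : R).
Variable I : ideal R.
Hypotheses (I_hclosed : hclosed I) (I_proper : ~ I 1).

Definition initial_upset : set 'X_{1..n} :=
  [set m | exists f, I f /\ is_initial_monomial f m].

Lemma upset_initial : upset initial_upset.
Proof.
move=> m m' [f [If [mf fm]]]; exists (f * 'X_[m']); split; first exact: ideal_memMr.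
split=> [|w]; first by rewrite (perm_mem (msuppMX _ _)) addmC; exact: map_f.
rewrite (perm_mem (msuppMX _ _)) => /mapP[w' /fm[->|w'm] ->]; rewrite addmC.
  by left.
by right; exact: revlex_add.
Qed.

Lemma initial_idealE f : initial_ideal I f <-> monomial_ideal K upset_initial f.
Proof.
split; last first.
  apply: monomial_ideal_sub => m [g [Ig gm]].
  by apply: sub_ideal_gen; exists g, m; split.
apply: ideal_gen_sub => g [h [m [Ih hm ->]]].
by apply/(monomial_idealX K upset_initial); exists h.
Qed.

Lemma initial_idealX m : initial_ideal I 'X_[m] <-> initial_upset m.
Proof. by rewrite initial_idealE; exact: monomial_idealX. Qed.

Lemma hclosed_initial : hclosed (initial_ideal I).
Proof. by move=> k f; rewrite !initial_idealE; exact: hclosed_monomial_ideal. Qed.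

Lemma initial_proper : ~ initial_ideal I 1.
Proof.
rewrite -(mpolyX0 n K) initial_idealX => -[f [If [f0 _]]].
by have := hclosed_proper I_hclosed I_proper If f0; rewrite /= mdeg0.
Qed.

(** One division step: the component in degree [mdeg m] of an element of [I] with initial monomial
    [m] expresses ['X_[m]] modulo [I] by smaller monomials of the same degree. [P] is an arbitrary
    subspace containing [I], so that the step applies to ideals and to spans alike. *)
Lemma initial_upset_reduce (P : set R) m :
    (forall f, I f -> P f) -> (forall a f g, P f -> P g -> P (a *: f + g)) ->
    (forall m', mdeg m' = mdeg m -> revlex_lt m' m -> P 'X_[m']) ->
  initial_upset m -> P 'X_[m].
Proof.
move=> IP PD Plow [f [If [mf fm]]]; pose g := hpart (mdeg m) f.
have gm : g@_m != 0 by rewrite mcoeff_hpart eqxx -mcoeff_msupp.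
pose tl := \sum_(m' <- rem m (msupp g)) g@_m' *: 'X_[m'].
have gE : g = g@_m *: 'X_[m] + tl.
  by rewrite {1}[g]mpolyE (big_rem m) //= mcoeff_msupp.
have Ptl : P tl.
  rewrite /tl big_seq_cond; elim/big_rec: _ => [|m' h].
    by move=> *; apply: IP; exact: ideal_mem0.
  rewrite andbT (rem_filter _ (msupp_uniq _)) mem_filter /= msupp_hpart.
  move=> /and3P[m'm /eqP dm' /fm[/eqP|lt]]; first by rewrite (negPf m'm).
  by apply: PD; exact: Plow.
have -> : 'X_[m] = (- (g@_m)^-1) *: tl + (g@_m)^-1 *: g.
  rewrite {3}gE scalerDr scalerA mulVf // scale1r scaleNr addrCA.
  by rewrite addNr addr0.
by apply: PD => //; apply: IP; apply: ideal_memZ; exact: I_hclosed.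
Qed.

Lemma lastsum_initial s :
  (forall m, mdeg m = s -> lastsum d I 'X_[m]) <->
  (forall m, mdeg m = s -> lastsum d (initial_ideal I) 'X_[m]).
Proof.
split=> lastX m ms.
  have [lm|nlm] := pselect (last_upset d m).
    by apply: last_ideal_lastsum; exact/(monomial_idealX K (@upset_last n d)).
  apply: lastsumN; apply/initial_idealX.
  (* In ['X_[m] = g + h] every monomial of [g] other than [m] also occurs in [h], so it involves one
     of the last variables. In degree [s] these are smaller than [m], which is therefore the initial
     monomial of [hpart s g]. *)
  have /lastsumP[g [h [Ig Lh XE]]] := lastX m ms.
  exists (hpart s g); split; first exact: I_hclosed.
  have hm : h@_m = 0 by apply/eqP; rewrite mcoeff_eq0; apply/negP => /Lh.
  split.
    rewrite mcoeff_msupp mcoeff_hpart ms eqxx.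
    have := congr1 (mcoeff m) XE; rewrite mcoeffX eqxx mcoeffD hm addr0 => <-.
    exact: oner_neq0.
  move=> m'; rewrite msupp_hpart => /andP[/eqP m's m'g].
  have [->|ne] := eqVneq m' m; [by left | right].
  apply: (@revlex_last _ d) => //; first by rewrite m's.
  apply: Lh; rewrite mcoeff_msupp.
  have := congr1 (mcoeff m') XE; rewrite mcoeffX eq_sym (negPf ne) mcoeffD => /esym/eqP.
  by rewrite addrC addr_eq0 => /eqP ->; rewrite oppr_eq0 -mcoeff_msupp.
(* Conversely, a monomial free of the last variables lies in the initial ideal itself; a division
   step then reduces it to smaller monomials of degree [s], covered by induction. *)
elim/revlex_ind: m ms => m IHm ms.
have [lm|nlm] := pselect (last_upset d m).
  by apply: last_ideal_lastsum; exact/(monomial_idealX K (@upset_last n d)).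
have /lastsumP[g [h [/initial_idealE Ig Lh XE]]] := lastX m ms.
apply: (@initial_upset_reduce (lastsum d I)).
- by move=> f; exact: lastsumN.
- by move=> a f f' Lf Lf'; apply: ideal_memD => //; exact: ideal_memZ.
- by move=> m' m'm lt; apply: IHm => //; rewrite m'm.
apply: Ig; rewrite mcoeff_msupp.
have hm : h@_m = 0 by apply/eqP; rewrite mcoeff_eq0; apply/negP => /Lh.
have := congr1 (mcoeff m) XE; rewrite mcoeffX eqxx mcoeffD hm addr0 => <-.
exact: oner_neq0.
Qed.

(* The monomials outside the initial ideal span R / I; being independent modulo
   the initial ideal, they are no more than the given spanning elements. *)
Lemma initial_polynomial_growth k :
  polynomial_growth (initial_ideal I) k -> polynomial_growth I k.
Proof.
move=> [B growth]; exists B => T; have [F [e [cardF spanF]]] := growth T.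
pose G : finType := {x : 'X_{1..n < T.+1} | ~~ `[< initial_upset x >]}.
pose p (x : G) : R := 'X_[val (val x)].
exists G, p; split.
  apply: leq_trans cardF; rewrite leqNgt; apply/negP => FG.
  have [x|u [[x ux] Iu]] := @span_mod_dependent _ _ (initial_ideal I) F e G p FG.
    by apply: spanF; rewrite /p msizeX; exact: bmdeg.
  have /negP := valP x; apply; apply/asboolP.
  (* The coefficient of the relation at [x] is [u x], so [x] is in the support of an element of a
     monomial ideal that does not contain it. *)
  move/initial_idealE: Iu; apply; rewrite mcoeff_msupp raddf_sum /= (bigD1 x) //=.
  rewrite big1 => [|y yx]; rewrite mcoeffZ mcoeffX; last first.
    by rewrite (_ : (_ == _) = false) ?mulr0 //; apply: contra_neqF yx => /eqP /val_inj/val_inj.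
  by rewrite eqxx mulr1 addr0.
move=> f fT; apply: span_mod_msupp => m mf.
have : (mdeg m < T.+1)%N by exact: leq_trans (msize_mdeg_lt mf) fT.
elim/revlex_ind: m {mf} => m IHm mT.
have [im|nim] := pselect (initial_upset m).
  apply: initial_upset_reduce im => [g|a g h|m' _ lt].
  - exact: span_mod_ideal.
  - exact: span_modP.
  - by apply: IHm => //; exact: leq_ltn_trans (revlex_mdeg lt) mT.
have nx : ~~ `[< initial_upset (BMultinom mT) >] by apply/negP => /asboolP.
exact: (span_mod_basis I p (exist _ (BMultinom mT) nx : G)).
Qed.

End InitialIdeal.

(** * Nilpotency of the variables modulo the ideal and the last [d] variables *)

Section FilterRegularVariables.
Variables (K : fieldType) (n d : nat).
Local Notation R := {mpoly K[n]}.
Local Notation hpart k := (@pihomog n K mdeg k).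
Variable I : ideal R.
Hypotheses (I_hclosed : hclosed I) (dim_d : has_krull_dim (quotient_ring I) d).
Hypothesis a_finite_length : forall i : nat, (1 <= i <= d)%N ->
  finite_length (seq_colon_quotient (rev_vars K n) I i).

Lemma order_ideal1P (f : R) : @order_ideal K n 1 f <-> f@_0 = 0.
Proof.
split=> [f1|f0 m mf /=].
  by apply/eqP; rewrite mcoeff_eq0; apply/negP => /f1 /=; rewrite mdeg0.
rewrite lt0n mdeg_eq0; apply/eqP => m0; move: mf.
by rewrite m0 mcoeff_msupp f0 eqxx.
Qed.

Lemma mcoeff0M (f g : R) : (f * g)@_0 = f@_0 * g@_0.
Proof. exact: (mcoeff0_is_multiplicative n K).1. Qed.

Lemma order_ideal1_prime : prime_ideal (@order_ideal K n 1).
Proof.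
split=> [/order_ideal1P/eqP|f g]; first by rewrite mcoeff1 eqxx oner_eq0.
rewrite !order_ideal1P mcoeff0M => /eqP; rewrite mulf_eq0.
by move=> /orP[] /eqP; [left | right].
Qed.

Lemma filter_regular_nilpotent (i : 'I_n) : exists k, lastsum d I ('X_i ^+ k).
Proof.
apply: contrapT => /forallNP nilp.
(* The powers of ['X_i] keep this variable out of [P]; the factors [s] with nonzero constant term
   force [P] into the irrelevant ideal, although [P] need not be homogeneous. *)
pose S : set R := [set f | exists k s, s@_0 != 0 /\ f = 'X_i ^+ k * s].
have [|||P [Pprime LP PS]] := @prime_avoiding _ (lastsum d I) S.
- by exists 0%N, 1; rewrite expr0 mulr1 mcoeff1 eqxx oner_neq0.
- move=> _ _ [k [s [s0 ->]]] [k' [s' [s'0 ->]]]; exists (k + k')%N, (s * s').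
  by rewrite mcoeff0M mulf_neq0 // exprD; split=> //; ring.
- move=> f Lf [k [s [s0 fE]]]; apply: (nilp k); subst f.
  (* The component of degree [k] of ['X_i ^+ k * s] is ['X_i ^+ k] times the constant term of
     [s]. *)
  have := @hclosed_lastsum _ _ d _ I_hclosed k _ Lf.
  rewrite mpolyXn hpartXM mdegMn mdeg1 mul1n leqnn subnn.
  have -> : hpart 0 s = (s@_0)%:MP.
    apply/mpolyP => m; rewrite mcoeff_hpart mcoeffC mdeg_eq0.
    by case: eqVneq => [->|_]; rewrite ?mulr1 ?mulr0.
  rewrite mulrC mul_mpolyC => /(ideal_memZ (s@_0)^-1).
  by rewrite scalerA mulVf // scale1r.
have P1 : P `<=` @order_ideal K n 1.
  move=> f Pf; apply/order_ideal1P/eqP; apply: contrapT => /negP f0.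
  by apply: (PS f Pf); exists 0%N, f; rewrite expr0 mul1r.
have PX : ~ P 'X_i.
  move=> /PS; apply; exists 1%N, 1; rewrite expr1 mulr1 mcoeff1 eqxx.
  by rewrite oner_neq0.
have [|||||C [IC Cd Cprime Clt]] := @filter_regular_chain _ (rev_vars K n) I 'X_i d P.
- exact: a_finite_length.
- exact: Pprime.
- by move=> f /(@ideal_add_seq_lastsum _ _ d I d (leqnn d))/LP.
- exact: PX.
- move=> a /P1/order_ideal1P/eqP; rewrite mcoeffB mcoeff0M mcoeffX mnm1_eq0.
  by rewrite mulr0 subr0 mcoeff1 eqxx oner_eq0.
have : (d.+1 <= d)%N; last by rewrite ltnn.
apply: dim_d.2.
(* The irrelevant ideal is put on top of the chain ending in [P]; the inclusion is strict because
   only the former contains ['X_i]. *)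
apply: (@quotient_prime_chain _ _ _
  (fun j => if (j <= d)%N then C j else @order_ideal K n 1)) => //= j.
- by move=> _; case: ifP => [/Cprime|_] //; exact: order_ideal1_prime.
- rewrite ltnS => jd; rewrite jd; have [lt|ge] := ltnP j d; first exact: Clt.
  have -> : j = d by apply/eqP; rewrite eqn_leq jd.
  rewrite Cd; split=> // oP; apply: PX; apply: oP.
  by apply/order_ideal1P; rewrite mcoeffX mnm1_eq0.
Qed.

End FilterRegularVariables.

Theorem lemma4p7 (K : fieldType) (n d : nat) (I : ideal {mpoly K[n]})
    (K_infinite : infinite_set [set: K])
    (I_neq0 : ideal_set I <> [set 0])
    (I_proper : ideal_set I <> setT)
    (I_homog : homogeneous_ideal (homogeneous_poly K n) I)
    (dim_d : has_krull_dim (quotient_ring I) d)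
    (a_finite_length : forall i : nat, (1 <= i <= d)%N ->
       finite_length (seq_colon_quotient (rev_vars K n) I i)) :
  let J := last_vars_ideal I d in
  let L := last_vars_ideal (initial_ideal I) d in
  [/\ is_minimal_reduction (homogeneous_quotient I) (irrelevant_ideal I) J,
      is_minimal_reduction (homogeneous_quotient (initial_ideal I))
        (irrelevant_ideal (initial_ideal I)) L
    & reduction_number (irrelevant_ideal I) J =
      reduction_number (irrelevant_ideal (initial_ideal I)) L].
Proof.
move=> J L.
have hI := homogeneous_hclosed I_homog.
have nI1 : ~ I 1.
  move=> I1; apply: I_proper; rewrite eqEsubset; split=> // f _.
  by rewrite -[f]mulr1; exact: ideal_memMl.
have hin := hclosed_initial (I := I).
have nin1 := initial_proper hI nI1.
have redJ := reduction_at_last_vars d hI nI1.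
have redL := reduction_at_last_vars d hin nin1.
have redE r : reduction_at (irrelevant_ideal I) J r <->
    reduction_at (irrelevant_ideal (initial_ideal I)) L r.
  by rewrite redJ redL; exact: lastsum_initial.
have [r redr] : exists r, reduction_at (irrelevant_ideal I) J r.
  have [r lastr] := lastsum_nilpotent (filter_regular_nilpotent hI dim_d a_finite_length).
  by exists r; exact/redJ.
split.
- apply: last_vars_minimal_reduction => //; first by exists r.
  move=> k s l l1 lX; apply: (prime_chain_growth (I := I)) dim_d.1.
  exact: linear_quotient_growth lX.
- apply: last_vars_minimal_reduction => //; first by exists r; exact/redE.
  (* The chain of primes is given for [R / I] only, so the growth bound for the initial ideal is
     first transferred to [I]. *)
  move=> k s l l1 lX; apply: (prime_chain_growth (I := I)) dim_d.1.
  apply: initial_polynomial_growth => //.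
  exact: linear_quotient_growth lX.
rewrite /reduction_number; congr (xget _ _); apply/seteqP; split=> s [/= red mins].
  by split=> [|u /redE]; [exact/redE | exact: mins].
by split=> [|u /redE]; [exact/redE | exact: mins].
Qed.
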